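(* Let $1<\gamma<2$, $0\le\delta\le 1$, $T>0$, $c,x,y\in\mathbb{R}$, and let $\eta\in C^{1}([0,T],\mathbb{R})$. Then $$\omega(t)=t^{\gamma+\delta(2-\gamma)-2}E_{\gamma,\gamma+\delta(2-\gamma)-1}(ct^{\gamma})\,x+t^{\gamma+\delta(2-\gamma)-1}E_{\gamma,\gamma+\delta(2-\gamma)}(ct^{\gamma})\,y+\int_{0}^{t}(t-s)^{\gamma-1}E_{\gamma,\gamma}(c(t-s)^{\gamma})\eta(s)\,ds$$ is a solution of the problem $$D_{0}^{\gamma,\delta}\omega(t)=c\,\omega(t)+\eta(t),\quad t\in(0,T],$$ $$(g_{(1-\delta)(2-\gamma)}*\omega)(0)=x,\qquad (g_{(1-\delta)(2-\gamma)}*\omega)'(0)=y.$$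
   Context: For $\alpha>0$, $J_t^{\alpha}\omega(t)=\frac{1}{\Gamma(\alpha)}\int_0^t(t-s)^{\alpha-1}\omega(s)\,ds$ is the Riemann-Liouville fractional integral, and $J_t^0$ is the identity. For $1<\gamma<2$ and $0\le\delta\le1$ the Hilfer fractional derivative of order $\gamma$ and type $\delta$ is $D_0^{\gamma,\delta}\omega(t)=J_t^{\delta(2-\gamma)}\frac{d^2}{dt^2}J_t^{(1-\delta)(2-\gamma)}\omega(t)$, $t>0$. Here $g_\alpha(t)=t^{\alpha-1}/\Gamma(\alpha)$ for $\alpha>0$, so $g_\alpha*\omega=J_t^\alpha\omega$, with the convention $g_0*\omega=\omega$. Values at $0$ in the initial conditions are understood as limits as $t\to0+$. A solution is a function satisfying the equation and the initial conditions. $E_{\alpha,\beta}(z)=\sum_{k=0}^\infty \frac{z^k}{\Gamma(\alpha k+\beta)}$ is the two-parameter Mittag-Leffler function. *)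

(* Defs.v *)
From mathcomp Require Import all_boot all_order all_algebra.
From mathcomp Require Import all_classical all_reals all_analysis.
Set Implicit Arguments.
Unset Strict Implicit.
Unset Printing Implicit Defensive.
Import Order.TTheory GRing.Theory Num.Theory.
Import numFieldNormedType.Exports.
Local Open Scope classical_set_scope.
Local Open Scope ring_scope.

Section defs.
Context {R : realType}.
Implicit Types (a b c x y t z T gamma delta : R) (f h w eta : R -> R) (D : set R).
Local Notation mu := (@lebesgue_measure R).

(* This is the Gamma function for a > 0, the only range needed here; all
   integrals are Lebesgue integrals. *)
Definition Gamma_fun a : R :=
  \int[mu]_(s in `]0, +oo[) (s `^ (a - 1) * expR (- s)).

Definition mittag_leffler a b z : R :=
  limn (series (fun k : nat => z ^+ k / Gamma_fun (a * k%:R + b))).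

Definition g_kernel a t : R := t `^ (a - 1) / Gamma_fun a.

(* Convolution on the half-line. The domain is open because the functions of
   interest are only meaningful on ]0, T], and kernels may be singular at 0. *)
Definition convol f h t : R := \int[mu]_(s in `]0, t[) (f (t - s) * h s).

Definition g_convol a w : R -> R :=
  if a == 0 then w else convol (g_kernel a) w.

Definition RL_integral a w t : R :=
  if a == 0 then w t
  else (Gamma_fun a)^-1 * \int[mu]_(s in `]0, t[) ((t - s) `^ (a - 1) * w s).

(* Rintegral returns 0 on divergent integrals, hence this predicate. *)
Definition RL_integrable a w t : Prop :=
  a != 0 ->
  mu.-integrable `]0, t[ (fun s => ((t - s) `^ (a - 1) * w s)%:E).

(* Derivatives relative to a domain D: one-sided at an endpoint belonging to D,
   and the usual derivative at an interior point. *)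
Definition diff_quot f t s : R := (f s - f t) / (s - t).

Definition derivable_on D f : Prop :=
  forall t, D t -> cvg (diff_quot f t s @[s --> within D t^']).

Definition derive_on D f t : R := lim (diff_quot f t s @[s --> within D t^']).

Definition C1_on D f : Prop :=
  derivable_on D f /\ {within D, continuous (derive_on D f)}.

Definition hilfer T gamma delta w : R -> R :=
  RL_integral (delta * (2 - gamma))
    (derive_on `]0, T]
      (derive_on `]0, T] (RL_integral ((1 - delta) * (2 - gamma)) w))).

(* Every integral and derivative occurring in [hilfer] exists on ]0, T]. *)
Definition hilfer_exists T gamma delta w : Prop :=
  let v := RL_integral ((1 - delta) * (2 - gamma)) w in
  let dv := derive_on `]0, T] v in
  [/\ forall t, 0 < t <= T -> RL_integrable ((1 - delta) * (2 - gamma)) w t,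
      derivable_on `]0, T] v,
      derivable_on `]0, T] dv &
      forall t, 0 < t <= T ->
        RL_integrable (delta * (2 - gamma)) (derive_on `]0, T] dv) t].

Definition is_solution T gamma delta c eta x y w : Prop :=
  let gw := g_convol ((1 - delta) * (2 - gamma)) w in
  [/\ hilfer_exists T gamma delta w,
      forall t, 0 < t <= T -> hilfer T gamma delta w t = c * w t + eta t,
      gw t @[t --> 0^'+] --> x &
      derive_on `]0, T] gw t @[t --> 0^'+] --> y].

End defs.

(* Main.v *)
(* With e_b(t) = t^(b-1) E_{gamma,b}(c t^gamma) and g_b the Riemann-Liouville
   kernels, everything reduces to the commutative convolution algebra on the
   half-line:
     g_a * g_b = g_(a+b),   g_a * e_b = e_(a+b),   e_b = g_b + c e_(b+gamma).
   Put a = (1-delta)(2-gamma) and b = delta(2-gamma), so that a + b + gamma = 2,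
   and write eta = eta(0) + g_1 * eta'. The candidate is
     w = x e_(gamma+b-1) + y e_(gamma+b) + e_gamma * eta.
   The three rules give
     g_a * w = x + g_1 * (y + g_1 * F),
     F = c x e_(gamma-1) + c y e_gamma + eta(0) e_(1-b) + e_(1-b) * eta',
   so (g_a * w)'' = F by the fundamental theorem of calculus, both initial values
   can be read off because g_1 * f vanishes at 0+, and the same rules yield
   g_b * F = c w + eta. The kernels are singular at 0, hence the convolution
   algebra is built on functions that are continuous for t > 0 and dominated by
   some g_a with a > 0 near 0. *)

Require Import Defs.
From HB Require Import structures.
From mathcomp Require Import all_boot all_order all_algebra.
From mathcomp Require Import all_classical all_reals all_analysis.
From mathcomp Require Import measurable_realfun ring lra.
Import Order.TTheory GRing.Theory Num.Theory.
Import numFieldNormedType.Exports.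
Set Implicit Arguments.
Unset Strict Implicit.
Unset Printing Implicit Defensive.
Local Open Scope classical_set_scope.
Local Open Scope ring_scope.

(** * Affine changes of variables *)

Section change_of_variables.
Context {R : realType}.
Local Notation mu := (@lebesgue_measure R).

(** Functions are extended by zero to the nonpositive reals and convolved over the whole line, so
    that commutativity and associativity come from reflection, translation and Fubini's theorem,
    without indicator functions or moving endpoints. The problem itself only sees values on ]0, T];
    the candidate and eta are therefore replaced by admissible representatives that agree with them
    there and continue past T, which makes the derivative at T an ordinary two-sided one. The
    obstacle is positivity: a kernel is integrable near 0 only if its index is positive. Formally,
    differentiating g_a * e_gamma * eta twice leads to the index a + gamma - 2 = -b, which is not
    positive; one derivative is moved onto eta instead, and this is where its C^1 regularity enters.
    No singular kernel is ever differentiated: F is written down directly, and g_a * w is recovered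
    by integrating F twice. *)

Lemma measurable_affine (k r : R) : measurable_fun [set: R] (fun x : R => k * x + r).
Proof.
by apply: measurable_funD => //; apply: measurable_funM.
Qed.

(** By uniqueness of Lebesgue measure it suffices to look at half-open intervals, whose preimages
    are shorter by the factor [k]. *)
Lemma lebesgue_measure_affine (k r : R) (k0 : 0 < k) (A : set R) :
  measurable A ->
  mu A = (k%:E * pushforward mu (fun x : R => k * x + r : measurableTypeR R)%R A)%E.
Proof.
move=> mA.
pose phi : R -> measurableTypeR R := fun x => k * x + r.
have mphi : measurable_fun [set: measurableTypeR R] phi by exact: measurable_affine.
pose P : {measure set (measurableTypeR R) -> \bar R} :=
  measure_function_pushforward__canonical__measure_function_Measure mu mphi.
pose m := mscale (NngNum (ltW k0)) P.
rewrite (@lebesgue_measure_unique R m)// => _ [[a b]] _ <-.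
transitivity (k%:E * mu (phi @^-1` `]a, b]))%E; last by [].
rewrite (_ : _ @^-1` _ = `](a - r) / k, (b - r) / k]%classic); last first.
  apply/seteqP; split => x /=; rewrite !in_itv/= /phi ltr_pdivrMr// ler_pdivlMr//;
  rewrite ltrBlDr lerBrDr mulrC => //.
rewrite !lebesgue_measure_itv/= !lte_fin ltr_pM2r ?invr_gt0// ltrD2r.
case: ifPn => _; last by rewrite mule0.
by rewrite !EFinN -!EFinB -EFinM; congr EFin; field; rewrite gt_eqF.
Qed.

Lemma ge0_integral_affine (k r : R) (f : R -> \bar R) : 0 < k ->
  measurable_fun [set: R] f -> (forall x, 0 <= f x)%E ->
  (\int[mu]_x f x = k%:E * \int[mu]_x f (k * x + r)%R)%E.
Proof.
move=> k0 mf f0.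
pose phi : R -> measurableTypeR R := fun x => k * x + r.
have mphi : measurable_fun [set: measurableTypeR R] phi by exact: measurable_affine.
pose P : {measure set (measurableTypeR R) -> \bar R} :=
  measure_function_pushforward__canonical__measure_function_Measure mu mphi.
have := @ge0_integral_pushforward _ _ (measurableTypeR R) _ R phi mphi mu setT f
  measurableT mf (fun x _ => f0 x).
rewrite preimage_setT => <-.
rewrite -(@ge0_integral_mscale _ _ _ P _ measurableT (NngNum (ltW k0)))//.
apply: eq_measure_integral => A mA _.
by rewrite /mscale/=; exact: lebesgue_measure_affine.
Qed.

Lemma ge0_integral_opp (f : R -> \bar R) :
  measurable_fun [set: R] f -> (forall x, 0 <= f x)%E ->
  (\int[mu]_x f x = \int[mu]_x f (- x)%R)%E.
Proof.
move=> mf f0.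
have mphi : measurable_fun [set: measurableTypeR R] (-%R : R -> measurableTypeR R) by [].
have := @ge0_integral_pushforward _ _ _ _ R _ mphi mu setT f measurableT mf (fun x _ => f0 x).
rewrite preimage_setT => <-.
by apply: eq_measure_integral => //= A mA AS; exact/esym/lebesgue_measureN.
Qed.

Lemma ge0_integral_shift (r : R) (f : R -> \bar R) :
  measurable_fun [set: R] f -> (forall x, 0 <= f x)%E ->
  (\int[mu]_x f x = \int[mu]_x f (x + r)%R)%E.
Proof.
move=> mf f0; rewrite (@ge0_integral_affine 1 r)// mul1e.
by under eq_integral do rewrite mul1r.
Qed.

Lemma ge0_integral_reflect (t : R) (f : R -> \bar R) :
  measurable_fun [set: R] f -> (forall x, 0 <= f x)%E ->
  (\int[mu]_x f x = \int[mu]_x f (t - x)%R)%E.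
Proof.
move=> mf f0; rewrite (@ge0_integral_shift t)// ge0_integral_opp//.
  by under eq_integral do rewrite addrC.
by apply: measurableT_comp => //; exact: measurable_funD.
Qed.

(** Common core of translation, reflection and scaling: the hypothesis, available for nonnegative
    functions, is applied to the positive and negative parts of [f], whose integrals are finite. *)
Lemma Rintegral_change (phi : R -> R) (k : R) (f : R -> R) : 0 < k ->
  (forall g : R -> \bar R, measurable_fun [set: R] g -> (forall x, 0 <= g x)%E ->
     \int[mu]_x g x = k%:E * \int[mu]_x g (phi x))%E ->
  mu.-integrable setT (EFin \o f) ->
  \int[mu]_x f x = k * \int[mu]_x f (phi x).
Proof.
move=> k0 H fi; have /integrableP[mf _] := fi.
rewrite /Rintegral.
have -> : (\int[mu]_x (f x)%:E = k%:E * \int[mu]_x (f (phi x))%:E)%E.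
  rewrite integralE [in RHS]integralE.
  have fp := integrable_fin_num measurableT (integrable_funepos measurableT fi).
  have fn := integrable_fin_num measurableT (integrable_funeneg measurableT fi).
  move: fp fn.
  rewrite (H _ (measurable_funepos mf) (funepos_ge0 _)).
  rewrite (H _ (measurable_funeneg mf) (funeneg_ge0 _)).
  rewrite (_ : (fun x => (f (phi x))%:E)^\+ = (EFin \o f)^\+ \o phi)%E; last first.
    by rewrite -funepos_comp.
  rewrite (_ : (fun x => (f (phi x))%:E)^\- = (EFin \o f)^\- \o phi)%E; last first.
    by rewrite -funeneg_comp.
  rewrite /comp.
  set X := integral _ _ _; set Y := integral _ _ _ => fp fn.
  have X0 : (0 <= X)%E by exact: integral_ge0.
  have Y0 : (0 <= Y)%E by exact: integral_ge0.
  have Xf : X \is a fin_num.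
    by case: X fp X0 => // ; rewrite gt0_muley.
  have Yf : Y \is a fin_num.
    by case: Y fn Y0 => // ; rewrite gt0_muley.
  rewrite [RHS]muleBr//; apply: fin_num_adde_defl; by rewrite fin_numN.
(* [fine] sends both infinities to 0, so the factor [k] also comes out in those cases. *)
case: (integral _ _ _) => // ; rewrite ?gt0_muley ?gt0_muleNy//= ?mulr0//.
Qed.

Lemma Rintegral_shift (r : R) (f : R -> R) : mu.-integrable setT (EFin \o f) ->
  \int[mu]_x f x = \int[mu]_x f (x + r).
Proof.
move=> fi; rewrite -[RHS]mul1r; apply: Rintegral_change => // g mg g0.
by rewrite mul1e; exact: ge0_integral_shift.
Qed.

Lemma Rintegral_reflect (t : R) (f : R -> R) : mu.-integrable setT (EFin \o f) ->
  \int[mu]_x f x = \int[mu]_x f (t - x).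
Proof.
move=> fi; rewrite -[RHS]mul1r.
apply: (@Rintegral_change (fun x => t - x)) => // g mg g0.
by rewrite mul1e; exact: ge0_integral_reflect.
Qed.

Lemma Rintegral_scale (k : R) (f : R -> R) : 0 < k ->
  mu.-integrable setT (EFin \o f) ->
  \int[mu]_x f x = k * \int[mu]_x f (k * x).
Proof.
move=> k0 fi; apply: Rintegral_change => // g mg g0.
rewrite (@ge0_integral_affine k 0)//.
by under eq_integral do rewrite addr0.
Qed.

End change_of_variables.

(** * The Gamma function and the Beta integral *)

Section gamma_function.
Context {R : realType}.
Local Notation mu := (@lebesgue_measure R).
Implicit Types (a b s t : R).

(** The restriction to ]0, +oo[ matters: [powR] takes nonzero default values on the negative
    reals. *)
Definition pospow a : R -> R := (fun s => s `^ (a - 1)) \_ `]0, +oo[.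

Lemma pospowE a t : 0 < t -> pospow a t = t `^ (a - 1).
Proof. by move=> t0; rewrite /pospow patchE mem_set//= in_itv/= t0. Qed.

Lemma pospow_le0 a t : t <= 0 -> pospow a t = 0.
Proof.
by move=> t0; rewrite /pospow patchE memNset//= in_itv/= andbT; apply/negP; rewrite -leNgt.
Qed.

Lemma pospow_ge0 a t : 0 <= pospow a t.
Proof.
have [t0|t0] := ltP 0 t; first by rewrite pospowE// powR_ge0.
by rewrite pospow_le0.
Qed.

Lemma measurable_pospow a : measurable_fun setT (pospow a).
Proof.
by apply/(measurable_restrictT _ _).1 => //; apply: measurable_funTS; exact: measurable_powR.
Qed.

Lemma continuous_powR a t : 0 < t -> {for t, continuous (fun s : R => s `^ a)}.
Proof.
move=> t0; have /derivable1_diffP/differentiable_continuous : derivable (fun s : R => s `^ a) t 1.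
  by apply: derivable_powR; rewrite in_itv/= andbT.
by [].
Qed.

(** The fundamental theorem applies only away from the singularity, hence on [[u n, 1]] with the
    primitive s^a / a; monotone convergence then exhausts ]0, 1]. *)
Lemma integral_powR_itv01 a : 0 < a ->
  (\int[mu]_(s in `]0%R, 1%R]) (s `^ (a - 1))%:E <= (a^-1)%:E)%E.
Proof.
move=> a0.
pose u (n : nat) : R := n.+1%:R^-1.
have u0 n : 0 < u n by rewrite invr_gt0.
pose g n : R -> \bar R := (fun s => (s `^ (a - 1))%:E) \_ `[u n, 1].
have mg n : measurable_fun (`]0%R, 1%R]%classic : set R) (g n).
  apply: measurable_funTS.
  have mi : measurable (`[u n, 1]%classic : set R) by [].
  apply: (measurable_restrictT (fun s : R => (s `^ (a - 1))%:E) mi).1.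
  by apply: measurable_funTS; apply/measurable_EFinP; exact: measurable_powR.
have g0 n s : `]0%R, 1%R]%classic s -> (0 <= g n s)%E.
  by move=> _; apply: erestrict_ge0 => // x _; rewrite lee_fin powR_ge0.
have gnd s : `]0%R, 1%R]%classic s -> {homo g^~ s : n m / (n <= m)%N >-> (n <= m)%E}.
  move=> _ n m nm; rewrite /g /patch; case: ifPn => [|_].
    rewrite inE /= in_itv/= => /andP[h1 h2]; rewrite mem_set//= in_itv/= h2 andbT.
    by apply: le_trans h1; rewrite /u lef_pV2 ?posrE// ler_nat.
  by case: ifPn => _ //; rewrite lee_fin powR_ge0.
have -> : (\int[mu]_(s in `]0%R, 1%R]) (s `^ (a - 1))%:E =
         \int[mu]_(s in `]0%R, 1%R]) limn (g^~ s))%E.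
  apply: eq_integral => s; rewrite inE/= in_itv/= => /andP[s0 s1].
  apply/esym/cvg_lim => //; apply: cvg_near_cst.
  near=> n; rewrite /g patchE mem_set//= in_itv/= s1 andbT.
  rewrite /u -[leRHS]invrK lef_pV2 ?posrE ?invr_gt0//.
  near: n; exists (Num.truncn s^-1) => // m /= hm.
  rewrite (le_trans (ltW (truncnS_gt _)))// ler_nat; exact: hm.
rewrite monotone_convergence//.
apply: lime_le.
  apply: ereal_nondecreasing_is_cvgn => n m nm; apply: ge0_le_integral => //.
  - by move=> x; exact: g0.
  - exact: mg.
  - exact: mg.
  - by move=> x hx; exact: gnd.
apply: nearW => n.
rewrite /g -integral_mkcondr setIidr; last first.
  by move=> s /=; rewrite !in_itv/= => /andP[h1 ->]; rewrite (lt_le_trans _ h1).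
(* For [n = 0] the interval is the single point 1, while the fundamental theorem wants distinct
   endpoints. *)
have [un1|un1] := ltP (u n) 1; last first.
  rewrite (@le_trans _ _ 0%E)//; last by rewrite lee_fin invr_ge0 ltW.
  have [->|un] := eqVneq (u n) 1; first by rewrite set_itv1 integral_set1.
  by rewrite set_itv_ge ?integral_set0// -leNgt bnd_simp lt_neqAle eq_sym un.
rewrite (@continuous_FTC2 _ _ (fun s => a^-1 * s `^ a))//.
- rewrite powR1 mulr1 -EFinB lee_fin gerBl mulr_ge0// ?powR_ge0// invr_ge0 ltW//.
- apply: continuous_in_subspaceT => s; rewrite inE/= in_itv/= => /andP[h1 _].
  by apply: continuous_powR; rewrite (lt_le_trans _ h1).
- have cv s : 0 < s -> {for s, continuous (fun s => a^-1 * s `^ a)}.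
    move=> s0; apply: cvgM; first exact: cvg_cst.
    exact: continuous_powR.
  split.
  + move=> s; rewrite in_itv/= => /andP[h1 _]; apply: derivableM => //.
    by apply: derivable_powR; rewrite in_itv/= andbT (lt_trans _ h1).
  + by apply/cvg_at_right_filter; exact: cv.
  + by apply/cvg_at_left_filter; exact: cv.
- move=> s; rewrite in_itv/= => /andP[h1 _].
  have s0 : 0 < s by rewrite (lt_trans _ h1).
  rewrite derive1Ml; last by apply: derivable_powR; rewrite in_itv/= andbT.
  by rewrite powR_derive1 ?in_itv/= ?andbT// mulKf// gt_eqF.
Unshelve. all: by end_near. Qed.

(** With p = |a| + 1 the exponent a - 1 is at most p, and ln v <= v - 1 at v = s / (2p) gives p ln s
    <= p ln (2p) + s / 2. The dilation by 2p is chosen to obtain the rate 1/2, which leaves half of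
    the decay of exp (-s). *)
Lemma powR_le_expR a s : 1 <= s ->
  s `^ (a - 1) <= expR ((`|a| + 1) * ln (2 * (`|a| + 1))) * expR (s / 2).
Proof.
move=> s1; set p := `|a| + 1.
have s0 : 0 < s by rewrite (lt_le_trans _ s1).
have p0 : 0 < p by rewrite ltr_wpDl.
rewrite (@le_trans _ _ (s `^ p))//.
  by apply: ler_powR => //; rewrite /p lerD// ?ler_norm// lerN10.
rewrite /powR gt_eqF// -expRD ler_expR.
have p2 : 0 < 2 * p by rewrite mulr_gt0.
have -> : ln s = ln (2 * p) + ln (1 + (s / (2 * p) - 1)).
  rewrite -lnM ?posrE//; first by congr ln; field; rewrite gt_eqF.
  by rewrite addrC subrK divr_gt0.
rewrite mulrDr lerD2l.
have := @le_ln1Dx _ (s / (2 * p) - 1); rewrite ltrBrDl subrr divr_gt0// => /(_ isT) h.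
rewrite (le_trans (ler_wpM2l (ltW p0) h))//.
rewrite mulrBr mulr1 (_ : p * _ = s / 2); last by field; rewrite gt_eqF.
by rewrite lerBlDr lerDl ltW.
Qed.

Definition gamma_dens a s : R := pospow a s * expR (- s).

Lemma gamma_dens_ge0 a s : 0 <= gamma_dens a s.
Proof. by rewrite mulr_ge0 ?pospow_ge0 ?expR_ge0. Qed.

Lemma measurable_gamma_dens a : measurable_fun setT (gamma_dens a).
Proof.
apply: measurable_funM; first exact: measurable_pospow.
by apply: measurableT_comp.
Qed.

Lemma integrable_gamma_dens a : 0 < a -> mu.-integrable setT (EFin \o gamma_dens a).
Proof.
move=> a0; apply/integrableP; split.
  by apply/measurable_EFinP; exact: measurable_gamma_dens.
(* The factor 2 cancels the rate 1/2 that normalises the exponential density in [h2]. *)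
pose K := 2 * expR ((`|a| + 1) * ln (2 * (`|a| + 1))).
have K0 : 0 <= K by rewrite mulr_ge0 ?expR_ge0.
pose h1 : R -> R := (fun s => s `^ (a - 1)) \_ `]0, 1].
pose h2 : R -> R := fun s => K * exponential_pdf 2^-1 s.
have h10 s : 0 <= h1 s by apply: restrict_ge0 => // x _; exact: powR_ge0.
have h20 s : 0 <= h2 s by rewrite mulr_ge0// exponential_pdf_ge0.
have mh1 : measurable_fun setT h1.
  by apply/(measurable_restrictT _ _).1 => //; apply: measurable_funTS; exact: measurable_powR.
have mh2 : measurable_fun setT h2.
  by apply: measurable_funM => //; exact: measurable_exponential_pdf.
apply: (@le_lt_trans _ _ (\int[mu]_s ((h1 s)%:E + (h2 s)%:E))%E).
  apply: ge0_le_integral => //.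
  - by apply: measurableT_comp => //; apply/measurable_EFinP; exact: measurable_gamma_dens.
  - by apply: emeasurable_funD; apply/measurable_EFinP.
  move=> s _ /=; rewrite ger0_norm ?gamma_dens_ge0// -EFinD lee_fin /gamma_dens.
  have [s0|s0] := ltP 0 s; last by rewrite pospow_le0// mul0r addr_ge0.
  rewrite pospowE//.
  have [s1|s1] := leP s 1.
    rewrite /h1 patchE mem_set/= ?in_itv/= ?s0 ?s1// -[leLHS]addr0 lerD//.
    by rewrite -[leRHS]mulr1 ler_wpM2l ?powR_ge0// -expR0 ler_expR oppr_le0 ltW.
  rewrite -[leLHS]add0r lerD// /h2 exponential_pdfE; last exact: ltW.
  apply: (le_trans (ler_wpM2r (expR_ge0 _) (powR_le_expR a (ltW s1)))).
  rewrite -mulrA -expRD /K.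
  rewrite (_ : s / 2 + - s = - 2^-1 * s); last by field.
  by rewrite mulrCA !mulrA mulVf// mul1r.
rewrite ge0_integralD//; last 4 first.
- by move=> x _; rewrite lee_fin.
- exact/measurable_EFinP.
- by move=> x _; rewrite lee_fin.
- exact/measurable_EFinP.
rewrite lte_add_pinfty//.
  rewrite (_ : (fun x => (h1 x)%:E) = (fun s => (s `^ (a - 1))%:E) \_ `]0, 1]); last first.
    by apply/funext => x; rewrite /h1 !patchE; case: ifP.
  rewrite -integral_mkcond; apply: le_lt_trans (integral_powR_itv01 a0) _.
  exact: ltry.
rewrite /h2; under eq_integral do rewrite EFinM.
rewrite ge0_integralZl//.
- by rewrite integral_exponential_pdf// mule1 ltry.
- by apply/measurable_EFinP; exact: measurable_exponential_pdf.
- by move=> x _; rewrite lee_fin exponential_pdf_ge0.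
Qed.

Lemma Gamma_funE a : 0 < a ->
  (Gamma_fun a)%:E = (\int[mu]_s (gamma_dens a s)%:E)%E.
Proof.
move=> a0; rewrite -[RHS]fineK; last first.
  by apply: integrable_fin_num (integrable_gamma_dens a0).
congr EFin; rewrite /Gamma_fun Rintegral_mkcond /Rintegral.
congr fine; apply: eq_integral => s _; congr EFin.
rewrite /gamma_dens /pospow !patchE; case: ifPn => // _.
by rewrite mul0r.
Qed.

(** The integral is cut down to [A, A + 1], where s^a, exp (-s) and 1 / s are bounded below
    separately. Since [A] is free, 1 / Gamma decays faster than any geometric sequence along
    arithmetic progressions, which makes the Mittag-Leffler series entire. *)
Lemma Gamma_fun_ge a A : 0 < a -> 0 < A ->
  A `^ a * (expR (- (A + 1)) / (A + 1)) <= Gamma_fun a.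
Proof.
move=> a0 A0; rewrite -lee_fin Gamma_funE//.
set K := leLHS.
have A1 : 0 < A + 1 by rewrite addr_gt0.
have K0 : 0 <= fine K by rewrite mulr_ge0 ?powR_ge0// divr_ge0 ?expR_ge0// ltW.
have -> : K = (\int[mu]_(s in `[A, (A + 1)%R]) K)%E.
  rewrite integral_cst//= lebesgue_measure_itv/= lte_fin ltrDl ltr01.
  by rewrite -EFinB addrAC subrr add0r mule1.
rewrite integral_mkcond; apply: ge0_le_integral => //.
- by move=> s _; apply: erestrict_ge0.
- by apply/(measurable_restrictT _ _).1 => //; exact: measurable_cst.
- by apply/measurable_EFinP; exact: measurable_gamma_dens.
move=> s _; rewrite patchE; case: ifPn => [|_]; last by rewrite lee_fin gamma_dens_ge0.
rewrite inE/= in_itv/= => /andP[As sA].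
have s0 : 0 < s by rewrite (lt_le_trans _ As).
rewrite lee_fin /gamma_dens pospowE// powRB ?(gt_eqF s0) ?implybT//.
rewrite powRr1; last exact: ltW.
rewrite -mulrA; apply: ler_pM; first exact: powR_ge0.
- by rewrite divr_ge0 ?expR_ge0// ltW.
- by apply: ge0_ler_powR => //; rewrite ?nnegrE ltW.
rewrite mulrC; apply: ler_pM; rewrite ?expR_ge0// ?ler_expR ?lerN2 ?lef_pV2 ?posrE//.
by rewrite invr_ge0 ltW.
Qed.

Lemma Gamma_fun_gt0 a : 0 < a -> 0 < Gamma_fun a.
Proof.
move=> a0; apply: lt_le_trans (Gamma_fun_ge a0 ltr01).
by rewrite mulr_gt0 ?powR_gt0// divr_gt0 ?expR_gt0// addr_gt0.
Qed.

Lemma Gamma_fun1 : Gamma_fun 1 = 1 :> R.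
Proof.
rewrite /Gamma_fun Rintegral_itv_obnd_cbnd; last first.
  have := integrable_gamma_dens (@ltr01 R).
  move/(@integrableS _ _ _ mu _ `]0, +oo[ _ measurableT (measurable_itv _) (@subsetT _ _)).
  apply: eq_integrable => // s; rewrite inE /= in_itv/= andbT => s0.
  by rewrite /gamma_dens pospowE.
rewrite Rintegral_mkcond.
transitivity (fine (\int[mu]_x (exponential_pdf 1 x)%:E)); last first.
  by rewrite integral_exponential_pdf.
congr fine; apply: eq_integral => s _; congr EFin.
rewrite /exponential_pdf !patchE; case: ifPn => // _.
by rewrite subrr powRr0 !mul1r mulN1r.
Qed.

End gamma_function.

(* Sealed because unification would otherwise unfold the integrals in order to
   compare two kernels of different orders. *)
HB.lock Definition gker {R : realType} (a t : R) : R := pospow a t / Gamma_fun a.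

Section riemann_liouville_kernel.
Context {R : realType}.
Local Notation mu := (@lebesgue_measure R).
Implicit Types (a b s t : R).

Lemma gkerE a t : 0 < t -> gker a t = g_kernel a t.
Proof. by move=> t0; rewrite gker.unlock pospowE. Qed.

Lemma gker_le0 a t : t <= 0 -> gker a t = 0.
Proof. by move=> t0; rewrite gker.unlock pospow_le0// mul0r. Qed.

Lemma gker_ge0 a t : 0 < a -> 0 <= gker a t.
Proof. by move=> a0; rewrite gker.unlock divr_ge0 ?pospow_ge0// ltW// Gamma_fun_gt0. Qed.

Lemma measurable_gker a : measurable_fun setT (gker a).
Proof. by rewrite gker.unlock; apply: measurable_funM => //; exact: measurable_pospow. Qed.

Lemma pospowM a k s : 0 < k -> pospow a (k * s) = k `^ (a - 1) * pospow a s.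
Proof.
move=> k0; have [s0|s0] := ltP 0 s.
  by rewrite !pospowE ?mulr_gt0// powRM// ltW.
by rewrite !pospow_le0 ?mulr0// pmulr_rle0.
Qed.

Lemma gkerM a k s : 0 < k -> gker a (k * s) = k `^ (a - 1) * gker a s.
Proof. by move=> k0; rewrite gker.unlock pospowM// mulrA. Qed.

Local Notation powconv a b t := (\int[mu]_s (pospow a (t - s)%R * pospow b s)%:E)%E.

Lemma powconv_ge0 a b t : (0 <= powconv a b t)%E.
Proof. by apply: integral_ge0 => s _; rewrite lee_fin mulr_ge0 ?pospow_ge0. Qed.

Lemma measurable_mul_shift (f g : R -> R) t :
  measurable_fun setT f -> measurable_fun setT g ->
  measurable_fun setT (fun s => f (t - s) * g s).
Proof.
move=> mf mg; apply: measurable_funM => //; apply: measurableT_comp => //.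
exact: measurable_funB.
Qed.

(** Homogeneity: the substitution of t s for s contributes a - 1 and b - 1 from the two powers and 1
    from the Jacobian. *)
Lemma powconv_scale a b t : 0 < t ->
  (powconv a b t = (t `^ (a + b - 1))%:E * powconv a b 1)%E.
Proof.
move=> t0.
have E := @ge0_integral_affine R t 0 (fun s => (pospow a (t - s) * pospow b s)%:E) t0.
rewrite {}E; last 2 first.
- by apply/measurable_EFinP; apply: measurable_mul_shift; exact: measurable_pospow.
- by move=> s; rewrite lee_fin mulr_ge0 ?pospow_ge0.
under eq_integral => s _.
  rewrite addr0 (_ : t - t * s = t * (1 - s)); last by rewrite mulrBr mulr1.
  rewrite !pospowM// mulrACA EFinM.
  over.
rewrite ge0_integralZl//.
- rewrite muleA -EFinM; congr (_%:E * _)%E.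
  rewrite -[X in X * _](powRr1 (ltW t0)) -!powRD ?(gt_eqF t0) ?implybT//.
  by congr powR; ring.
- by apply/measurable_EFinP; apply: measurable_mul_shift; exact: measurable_pospow.
- by move=> s _; rewrite lee_fin mulr_ge0 ?pospow_ge0.
- by rewrite lee_fin mulr_ge0 ?powR_ge0.
Qed.

Lemma measurable_mul_shift2 (f g : R -> R) :
  measurable_fun setT f -> measurable_fun setT g ->
  measurable_fun setT (fun p : R * R => f (p.1 - p.2) * g p.2).
Proof.
move=> mf mg; apply: measurable_funM; last exact: measurableT_comp.
by apply: measurableT_comp => //; exact: measurable_funB.
Qed.

(* Integrating the convolution of the two Gamma densities over the half-line
   in both orders gives Euler's formula for the Beta integral. *)
Lemma powconv1 a b : 0 < a -> 0 < b ->
  (powconv a b 1%R = (Gamma_fun a * Gamma_fun b / Gamma_fun (a + b))%:E)%E.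
Proof.
move=> a0 b0; have ab0 := addr_gt0 a0 b0.
have H : (\int[mu]_t \int[mu]_s (gamma_dens a (t - s)%R * gamma_dens b s)%:E =
          (Gamma_fun a * Gamma_fun b)%:E)%E.
  have := @fubini_tonelli _ _ _ _ R mu mu
    (fun p => (gamma_dens a (p.1 - p.2) * gamma_dens b p.2)%:E).
  move=> /= ->; last 2 first.
  - by apply/measurable_EFinP; apply: measurable_mul_shift2; exact: measurable_gamma_dens.
  - by move=> x; rewrite lee_fin mulr_ge0 ?gamma_dens_ge0.
  under eq_integral => s _.
    under eq_integral do rewrite EFinM muleC.
    rewrite ge0_integralZl//; last 3 first.
    - apply/measurable_EFinP; apply: measurableT_comp; first exact: measurable_gamma_dens.
      exact: measurable_funB.
    - by move=> t _; rewrite lee_fin gamma_dens_ge0.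
    - by rewrite lee_fin gamma_dens_ge0.
    rewrite -(@ge0_integral_shift R (- s) (EFin \o gamma_dens a)); last 2 first.
    - by apply/measurable_EFinP; exact: measurable_gamma_dens.
    - by move=> t; rewrite lee_fin gamma_dens_ge0.
    rewrite /comp -Gamma_funE// muleC.
    over.
  rewrite ge0_integralZl//.
  - by rewrite -Gamma_funE// EFinM.
  - by apply/measurable_EFinP; exact: measurable_gamma_dens.
  - by move=> t _; rewrite lee_fin gamma_dens_ge0.
  - by rewrite lee_fin ltW// Gamma_fun_gt0.
have : (powconv a b 1%R * (Gamma_fun (a + b))%:E = (Gamma_fun a * Gamma_fun b)%:E)%E.
  rewrite -H Gamma_funE// -ge0_integralZl//; last 3 first.
  - by apply/measurable_EFinP; exact: measurable_gamma_dens.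
  - by move=> t _; rewrite lee_fin gamma_dens_ge0.
  - exact: powconv_ge0.
  apply: eq_integral => t _.
  have [t0|t0] := ltP 0 t; last first.
    rewrite {1}/gamma_dens pospow_le0// mul0r mule0.
    rewrite integral0_eq// => s _; rewrite /gamma_dens.
    have [s0|s0] := ltP 0 s; last by rewrite [in X in _ * X]pospow_le0// mul0r mulr0.
    by rewrite [in X in X * _]pospow_le0 ?mul0r// subr_le0 (le_trans t0)// ltW.
  transitivity (\int[mu]_s ((expR (- t))%:E * (pospow a (t - s)%R * pospow b s)%:E))%E.
    rewrite ge0_integralZl//; last 2 first.
    - by apply/measurable_EFinP; apply: measurable_mul_shift; exact: measurable_pospow.
    - by move=> s _; rewrite lee_fin mulr_ge0 ?pospow_ge0.
    rewrite (@powconv_scale a b t t0) muleA -EFinM /gamma_dens pospowE// muleC.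
    by congr (_%:E * _)%E; rewrite mulrC.
  apply: eq_integral => s _; rewrite -EFinM; congr EFin.
  rewrite /gamma_dens (_ : - t = - (t - s) + - s); last by ring.
  by rewrite expRD; ring.
have /gt_eqF/negbT G0 := Gamma_fun_gt0 ab0.
(* Finiteness of the Beta integral is part of the conclusion: an infinite value times a positive
   Gamma value could not equal a finite product. *)
have := powconv_ge0 a b 1.
case: (integral _ _ _) => // [r _|_].
  by rewrite -EFinM => -[<-]; rewrite mulfK.
by rewrite gt0_mulye// lte_fin Gamma_fun_gt0.
Qed.

(** The extended-real form also yields finiteness, hence the integrability of products of kernels on
    which the domination arguments rest. *)
Lemma gker_cconv a b t : 0 < a -> 0 < b ->
  (\int[mu]_s (gker a (t - s)%R * gker b s)%:E = (gker (a + b) t)%:E)%E.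
Proof.
move=> a0 b0.
have [t0|t0] := ltP 0 t; last first.
  rewrite gker_le0// integral0_eq// => s _.
  have [s0|s0] := ltP 0 s; last by rewrite [X in _ * X]gker_le0// mulr0.
  by rewrite gker_le0 ?mul0r// subr_le0 (le_trans t0)// ltW.
rewrite gker.unlock.
under eq_integral do rewrite mulrACA mulrC EFinM.
rewrite ge0_integralZl//; last 3 first.
- by apply/measurable_EFinP; apply: measurable_mul_shift; exact: measurable_pospow.
- by move=> s _; rewrite lee_fin mulr_ge0 ?pospow_ge0.
- by rewrite lee_fin mulr_ge0// invr_ge0 ltW// Gamma_fun_gt0.
rewrite powconv_scale// powconv1// -!EFinM pospowE//; congr EFin.
have /gt_eqF/negbT Ga := Gamma_fun_gt0 a0.
have /gt_eqF/negbT Gb := Gamma_fun_gt0 b0.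
have /gt_eqF/negbT Gab := Gamma_fun_gt0 (addr_gt0 a0 b0).
move: (Gamma_fun a) (Gamma_fun b) (Gamma_fun (a + b)) Ga Gb Gab => A B C A0 B0 C0.
by field; rewrite A0 B0 C0.
Qed.

Lemma gker1 t : 0 < t -> gker 1 t = 1.
Proof. by move=> t0; rewrite gker.unlock pospowE// subrr powRr0 Gamma_fun1 divr1. Qed.

End riemann_liouville_kernel.

(** * The convolution algebra *)

HB.lock Definition cconv {R : realType} (f h : R -> R) (t : R) : R :=
  \int[@lebesgue_measure R]_s (f (t - s) * h s).

Section convolution.
Context {R : realType}.
Local Notation mu := (@lebesgue_measure R).
Implicit Types (a b s t x y T C : R) (f g h : R -> R).

(* No lower bound on [t]: since [gker a] vanishes on the nonpositive reals, so
   does every function satisfying this bound. *)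
Definition kerbound a f := forall T, exists C, forall t, t <= T -> `|f t| <= C * gker a t.

Definition admissible f :=
  (forall t, 0 < t -> {for t, continuous f}) /\ exists2 a, 0 < a & kerbound a f.

Lemma kerbound_ge0 a f T : 0 < a -> kerbound a f ->
  exists2 C, 0 <= C & forall t, t <= T -> `|f t| <= C * gker a t.
Proof.
move=> a0 /(_ T)[C fC]; exists (Num.max C 0); first by rewrite le_max lexx orbT.
move=> t tT; apply: le_trans (fC _ tT) _.
by rewrite ler_wpM2r ?gker_ge0// le_max lexx.
Qed.

Lemma kerbound_le0 a f t : kerbound a f -> t <= 0 -> f t = 0.
Proof.
move=> /(_ 0)[C fC] t0; have := fC _ t0.
by rewrite gker_le0// mulr0 normr_le0 => /eqP.
Qed.

Lemma adm_le0 f t : admissible f -> t <= 0 -> f t = 0.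
Proof. by case=> _ [a _ /kerbound_le0]; exact. Qed.

Lemma adm_measurable f : admissible f -> measurable_fun setT f.
Proof.
move=> fa; have -> : f = f \_ `]0, +oo[.
  apply/funext => s; rewrite patchE; case: ifPn => // /negP; rewrite inE/= in_itv/= andbT.
  by move=> /negP; rewrite -leNgt; exact: adm_le0.
apply/(measurable_restrictT _ _).1 => //; apply: open_continuous_measurable_fun => //.
by move=> s; rewrite inE/= in_itv/= andbT => s0; exact: fa.1.
Qed.

Lemma gker_mul_ge0 a b t s : 0 < a -> 0 < b -> 0 <= gker a t * gker b s.
Proof. by move=> a0 b0; apply: mulr_ge0; exact: gker_ge0. Qed.

(** The individual bounds hold only up to [T], yet [s] is arbitrary: off ]0, t[ one factor vanishes,
    and inside it both [t - s] and [s] are at most [T]. *)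
Lemma kerbound_mul a b f h T : 0 < a -> 0 < b -> kerbound a f -> kerbound b h ->
  exists2 C, 0 <= C & forall t s, t <= T ->
    `|f (t - s) * h s| <= C * (gker a (t - s) * gker b s).
Proof.
move=> a0 b0 fa hb; have [C1 C10 fC] := kerbound_ge0 T a0 fa.
have [C2 C20 hC] := kerbound_ge0 T b0 hb.
exists (C1 * C2); first exact: mulr_ge0.
move=> t s tT.
have rhs0 : 0 <= C1 * C2 * (gker a (t - s) * gker b s).
  by apply: mulr_ge0; [exact: mulr_ge0|exact: gker_mul_ge0].
have [s0|s0] := ltP 0 s; last by rewrite (kerbound_le0 hb s0) mulr0 normr0.
have [st|st] := ltP s t; last by rewrite (kerbound_le0 fa) ?mul0r ?normr0// subr_le0.
rewrite normrM mulrACA ler_pM//.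
- by apply: fC; rewrite lerBlDr ler_wpDr// ltW.
- by apply: hC; rewrite (le_trans (ltW st)).
Qed.

Lemma integrable_gker_cconv a b t : 0 < a -> 0 < b ->
  mu.-integrable setT (EFin \o (fun s => gker a (t - s) * gker b s)).
Proof.
move=> a0 b0; apply/integrableP; split.
  by apply/measurable_EFinP; apply: measurable_mul_shift; exact: measurable_gker.
under eq_integral do rewrite /= ger0_norm ?gker_mul_ge0//.
by rewrite gker_cconv// ltry.
Qed.

Lemma cconv_integrable f h t : admissible f -> admissible h ->
  mu.-integrable setT (EFin \o (fun s => f (t - s) * h s)).
Proof.
move=> fa ha; have [_ [a a0 fb]] := fa; have [_ [b b0 hb]] := ha.
have [C C0 fhC] := kerbound_mul t a0 b0 fb hb.
have H : mu.-integrable setT (EFin \o (fun s => C * (gker a (t - s) * gker b s))).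
  rewrite (_ : EFin \o _ = fun s => (C%:E * (gker a (t - s) * gker b s)%:E)%E); last first.
    by apply/funext => s; rewrite -EFinM.
  by apply: integrableZl => //; exact: integrable_gker_cconv.
apply: le_integrable H => //.
- apply/measurable_EFinP; apply: measurable_mul_shift; exact: adm_measurable.
- move=> s _ /=; rewrite lee_fin [leRHS]ger0_norm; first exact: fhC.
  by rewrite mulr_ge0// gker_mul_ge0.
Qed.

(** Domination passes to the convolution because kernels satisfy g_a * g_b = g_(a+b). The exact
    exponent is recorded because the limit at 0 in [cconv1_cvg0] depends on it. *)
Lemma cconv_bound a b f h : 0 < a -> 0 < b -> admissible f -> admissible h ->
  kerbound a f -> kerbound b h -> kerbound (a + b) (cconv f h).
Proof.
move=> a0 b0 fa ha fb hb T.
have [C C0 fhC] := kerbound_mul T a0 b0 fb hb.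
exists C => t tT; have fhi := cconv_integrable t fa ha.
rewrite cconv.unlock -lee_fin EFin_normr_Rintegral// (le_trans (le_abse_integral _ _ _))//.
  by have /integrableP[] := fhi.
rewrite EFinM -gker_cconv// -ge0_integralZl//; last 2 first.
- by apply/measurable_EFinP; apply: measurable_mul_shift; exact: measurable_gker.
- by move=> s _; rewrite lee_fin gker_mul_ge0.
apply: ge0_le_integral => //.
- by apply: measurableT_comp => //; have /integrableP[] := fhi.
- apply: emeasurable_funM => //.
  by apply/measurable_EFinP; apply: measurable_mul_shift; exact: measurable_gker.
by move=> s _; rewrite /= -EFinM lee_fin; exact: fhC.
Qed.

(** Powers increase or decrease according to the sign of [p]; the sum of both endpoint values serves
    either case. *)
Lemma powR_itv_bound p x y t : 0 < x -> x < t -> t < y -> t `^ p <= x `^ p + y `^ p.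
Proof.
move=> x0 xt ty; have t0 := lt_trans x0 xt; have y0 := lt_trans t0 ty.
have [p0|p0] := leP 0 p.
  rewrite -[leLHS]add0r lerD ?powR_ge0//.
  by apply: ge0_ler_powR => //; rewrite ?nnegrE ltW.
rewrite -[leLHS]addr0 lerD ?powR_ge0// -[p]opprK (powRN t) (powRN x).
rewrite lef_pV2 ?posrE ?powR_gt0//.
by apply: ge0_ler_powR; rewrite ?nnegrE ?oppr_ge0 ltW.
Qed.

Lemma cconv_continuous f h t : admissible f -> admissible h -> 0 < t ->
  {for t, continuous (cconv f h)}.
Proof.
move=> fa ha t0; have [fc [a a0 fb]] := fa; have [hc [b b0 hb]] := ha.
pose F x y := f (x - x * y) * h (x * y).
have scaleE x : 0 < x -> cconv f h x = x * \int[mu]_y F x y.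
  by move=> x0; rewrite cconv.unlock (@Rintegral_scale _ x)//; exact: cconv_integrable.
pose u := t / 2; pose v := 2 * t.
have u0 : 0 < u by rewrite divr_gt0.
have ut : u < t by rewrite /u ltr_pdivrMr// ltr_pMr// ltr1n.
have tv : t < v by rewrite /v mulrC ltr_pMr// ltr1n.
have [C C0 fhC] := kerbound_mul v a0 b0 fb hb.
(* Total power of x extracted by [gkerM] from the kernels at x (1 - y) and x y; [K] bounds it
   uniformly for x in ]u, v[. *)
pose p := (a - 1) + (b - 1).
pose K := C * (u `^ p + v `^ p).
have K0 : 0 <= K by rewrite mulr_ge0// addr_ge0// powR_ge0.
(* Rescaling to a fixed domain moves [t] into the integrand, which is then
   dominated uniformly for [t] in ]u, v[ despite the singularities. *)
suff cF : {in `]u, v[%classic, continuous (fun x => \int[mu]_y F x y)}.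
  have -> : {for t, continuous (cconv f h)} = (cconv f h x @[x --> t] --> cconv f h t) by [].
  rewrite scaleE//; apply: (@cvg_trans _ (x * \int[mu]_y F x y @[x --> t])).
    apply: near_eq_cvg; near=> x; rewrite scaleE//; near: x; exact: lt_nbhsr.
  have cFt : \int[mu]_y F x y @[x --> t] --> \int[mu]_y F t y.
    by apply: cF; rewrite inE/= in_itv/= ut tv.
  exact: (cvgM cvg_id cFt).
apply: (@continuity_under_integral _ _ _ mu F setT measurableT u v _ _
  (fun y => K * (gker a (1 - y) * gker b y))).
- move=> x /=; rewrite in_itv/= => /andP[ux xv]; have x0 := lt_trans u0 ux.
  have xi : mu.-integrable setT (EFin \o (fun y => f (x - y) * h y)) by exact: cconv_integrable.
  apply/integrableP; split.
    apply/measurable_EFinP; apply: measurable_funM.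
      apply: measurableT_comp; first exact: adm_measurable.
      by apply: measurable_funB => //; exact: measurable_funM.
    by apply: measurableT_comp; [exact: adm_measurable|exact: measurable_funM].
  have /integrableP[mxi] := xi.
  rewrite (@ge0_integral_affine _ x 0)//; last exact: measurableT_comp.
  under eq_integral do rewrite /= addr0.
  have [|] := leP +oo%E (\int[mu]_y `|(EFin \o F x) y|)%E.
    by rewrite leye_eq => /eqP ->; rewrite gt0_muley ?lte_fin.
  by [].
- apply: aeW => y _ x; rewrite inE/= in_itv/= => /andP[ux xv].
  have x0 := lt_trans u0 ux.
  have F0 : (forall z, 0 < z -> F z y = 0) -> F z y @[z --> x] --> F x y.
    move=> Fz; rewrite (Fz _ x0).
    by apply: cvg_near_cst; near=> z; rewrite Fz//; near: z; exact: lt_nbhsr.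
  have [y0|y0] := ltP 0 y; last first.
    apply: F0 => z z0; rewrite /F [X in _ * X](adm_le0 ha) ?mulr0//.
    by rewrite pmulr_rle0.
  have [y1|y1] := ltP y 1; last first.
    apply: F0 => z z0; rewrite /F (adm_le0 fa) ?mul0r//.
    by rewrite subr_le0 ler_peMr// ltW.
  have c1 : f (z - z * y) @[z --> x] --> f (x - x * y).
    apply: continuous_comp.
      by apply: cvgB; [exact: cvg_id|apply: cvgM; [exact: cvg_id|exact: cvg_cst]].
    by apply: fc; rewrite subr_gt0 gtr_pMr.
  have c2 : h (z * y) @[z --> x] --> h (x * y).
    apply: continuous_comp; first by apply: cvgM; [exact: cvg_id|exact: cvg_cst].
    by apply: hc; rewrite mulr_gt0.
  exact: (cvgM c1 c2).
- rewrite (_ : EFin \o _ = fun y => (K%:E * (gker a (1 - y) * gker b y)%:E)%E); last first.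
    by apply/funext => y; rewrite -EFinM.
  by apply: integrableZl => //; exact: integrable_gker_cconv.
- move=> x /=; rewrite in_itv/= => /andP[ux xv]; have x0 := lt_trans u0 ux.
  apply: aeW => y _; apply: (le_trans (fhC _ _ (ltW xv))).
  rewrite (_ : x - x * y = x * (1 - y)); last by ring.
  rewrite !gkerM// mulrACA -powRD ?(gt_eqF x0) ?implybT// mulrA.
  rewrite -(mulrA (x `^ _)) [leLHS](mulrA C).
  apply: ler_wpM2r; first exact: gker_mul_ge0.
  by apply: ler_wpM2l => //; exact: powR_itv_bound.
Unshelve. all: by end_near. Qed.

Lemma adm_cconv f h : admissible f -> admissible h -> admissible (cconv f h).
Proof.
move=> fa ha; split; first by move=> t t0; exact: cconv_continuous.
have [_ [a a0 fb]] := fa; have [_ [b b0 hb]] := ha.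
by exists (a + b); [exact: addr_gt0|exact: cconv_bound].
Qed.

Lemma cconvC f h : admissible f -> admissible h -> cconv f h = cconv h f.
Proof.
move=> fa ha; apply/funext => t.
rewrite cconv.unlock (@Rintegral_reflect _ t); last exact: cconv_integrable.
by apply: eq_Rintegral => s _; rewrite mulrC opprB addrCA subrr addr0.
Qed.

(** Writing t^(a-1) = t^(a-b) t^(b-1), the first factor is at most T^(a-b). Exponents can thus be
    lowered, which gives the two summands in [admD] a common one. *)
Lemma gker_le a b T : 0 < b -> b <= a ->
  exists2 C, 0 <= C & forall t, t <= T -> gker a t <= C * gker b t.
Proof.
move=> b0 ba; have a0 := lt_le_trans b0 ba.
exists (T `^ (a - b) * Gamma_fun b / Gamma_fun a).
  by rewrite !mulr_ge0 ?invr_ge0 ?powR_ge0// ltW ?Gamma_fun_gt0.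
move=> t tT; have [t0|t0] := ltP 0 t; last by rewrite !gker_le0// mulr0.
have /gt_eqF/negbT Gb := Gamma_fun_gt0 b0.
rewrite gker.unlock mulrACA mulrAC !pospowE//.
rewrite (_ : a - 1 = (a - b) + (b - 1)); last by ring.
rewrite powRD ?(gt_eqF t0) ?implybT//.
rewrite mulrA [X in _ <= X](_ : _ = T `^ (a - b) * t `^ (b - 1) / Gamma_fun a); last first.
  by move: (Gamma_fun a)^-1 (Gamma_fun b) Gb => A B B0; field.
apply: ler_wpM2r; first by rewrite invr_ge0 ltW// Gamma_fun_gt0.
apply: ler_wpM2r; first exact: powR_ge0.
by apply: ge0_ler_powR; rewrite ?nnegrE ?subr_ge0// ltW// (lt_le_trans t0).
Qed.

Lemma kerbound_weaken a b f : 0 < b -> b <= a -> kerbound a f -> kerbound b f.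
Proof.
move=> b0 ba fb T; have a0 := lt_le_trans b0 ba.
have [C C0 fC] := kerbound_ge0 T a0 fb; have [D D0 gD] := gker_le T b0 ba.
exists (C * D) => t tT; apply: (le_trans (fC _ tT)).
by rewrite -mulrA ler_wpM2l// gD.
Qed.

Lemma admD f g : admissible f -> admissible g -> admissible (f \+ g).
Proof.
move=> [fc [a a0 fb]] [gc [b b0 gb]]; split.
  by move=> t t0; apply: continuousD; [exact: fc|exact: gc].
exists (Num.min a b); first by rewrite lt_min a0.
have m0 : 0 < Num.min a b by rewrite lt_min a0.
move=> T.
have [|C C0 fC] := kerbound_ge0 T m0 (kerbound_weaken m0 _ fb); first by rewrite ge_min lexx.
have [|D D0 gD] := kerbound_ge0 T m0 (kerbound_weaken m0 _ gb).
  by rewrite ge_min lexx orbT.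
exists (C + D) => t tT; rewrite mulrDl (le_trans (ler_normD _ _))// lerD//.
- exact: fC.
- exact: gD.
Qed.

Lemma admZ (k : R) f : admissible f -> admissible (k \*o f).
Proof.
move=> [fc [a a0 fb]]; split.
  by move=> t t0; apply: continuousM; [exact: cvg_cst|exact: fc].
exists a => // T; have [C fC] := fb T; exists (`|k| * C) => t tT.
by rewrite normrM -mulrA ler_wpM2l// fC.
Qed.

Lemma adm_gker a : 0 < a -> admissible (gker a).
Proof.
move=> a0; split.
  move=> t t0; have -> : {for t, continuous (gker a)} = (gker a x @[x --> t] --> gker a t) by [].
  rewrite gkerE//; apply: (@cvg_trans _ (g_kernel a x @[x --> t])).
    apply: near_eq_cvg; near=> x; rewrite gkerE//; near: x; exact: lt_nbhsr.
  by have := cvgM (@continuous_powR _ (a - 1) t t0) (cvg_cst (Gamma_fun a)^-1); exact.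
by exists a => // T; exists 1 => t _; rewrite mul1r ger0_norm// gker_ge0.
Unshelve. all: by end_near. Qed.

Lemma cconv_gker a b : 0 < a -> 0 < b -> cconv (gker a) (gker b) = gker (a + b).
Proof. by move=> a0 b0; apply/funext => t; rewrite cconv.unlock /Rintegral gker_cconv. Qed.

Lemma cconvDr f g h : admissible f -> admissible g -> admissible h ->
  cconv f (g \+ h) = cconv f g \+ cconv f h.
Proof.
move=> fa ga ha; apply/funext => t /=; rewrite cconv.unlock -RintegralD//.
- by apply: eq_Rintegral => s _; rewrite mulrDr.
- exact: cconv_integrable.
- exact: cconv_integrable.
Qed.

Lemma cconvZr (k : R) f g : admissible f -> admissible g ->
  cconv f (k \*o g) = k \*o cconv f g.
Proof.
move=> fa ga; apply/funext => t /=; rewrite cconv.unlock -RintegralZl//.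
- by apply: eq_Rintegral => s _; rewrite mulrCA.
- exact: cconv_integrable.
Qed.

Lemma cconvDl f g h : admissible f -> admissible g -> admissible h ->
  cconv (f \+ g) h = cconv f h \+ cconv g h.
Proof.
move=> fa ga ha.
by rewrite (cconvC (admD fa ga) ha) cconvDr// (cconvC ha fa) (cconvC ha ga).
Qed.

Lemma cconvZl (k : R) f g : admissible f -> admissible g ->
  cconv (k \*o f) g = k \*o cconv f g.
Proof. by move=> fa ga; rewrite (cconvC (admZ k fa) ga) cconvZr// (cconvC ga fa). Qed.

Lemma EFin_Rintegral (D : set R) f : measurable D -> mu.-integrable D (EFin \o f) ->
  (\int[mu]_(x in D) f x)%:E = (\int[mu]_(x in D) (f x)%:E)%E.
Proof. by move=> mD fi; rewrite fineK//; exact: integrable_fin_num. Qed.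

(** This is the hypothesis of Fubini's theorem. Only [g] and [h] are replaced by kernels: the inner
    integral is then a multiple of [gker (b + c)], and what remains is the integrand of a
    convolution of two admissible functions. *)
Lemma integrable_cconv3 f g h t : admissible f -> admissible g -> admissible h ->
  (mu \x mu)%E.-integrable setT
    (fun p : R * R => (f (t - p.1) * (g (p.1 - p.2) * h p.2))%:E).
Proof.
move=> fa ga ha; have [_ [b b0 gb]] := ga; have [_ [c c0 hc]] := ha.
have bc0 := addr_gt0 b0 c0.
have [C C0 ghC] := kerbound_mul t b0 c0 gb hc.
have mP : measurable_fun setT
    (fun p : R * R => (f (t - p.1) * (g (p.1 - p.2) * h p.2))%:E).
  apply/measurable_EFinP; apply: measurable_funM.
    apply: measurableT_comp; first exact: adm_measurable.
    by apply: measurable_funB.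
  by apply: measurable_mul_shift2; exact: adm_measurable.
apply/(integrable12ltyP mu mu mP).
have fi := cconv_integrable t fa (adm_gker bc0).
have mfi : measurable_fun setT (fun s => `|(f (t - s) * gker (b + c) s)%:E|%E).
  by apply: measurableT_comp => //; have /integrableP[] := fi.
apply: (@le_lt_trans _ _ (\int[mu]_s (C%:E * `|(f (t - s)%R * gker (b + c) s)%:E|))%E).
  apply: ge0_le_integral => //.
  - by move=> s _; exact: integral_ge0.
  - have := @measurable_fun_fubini_tonelli_F _ _ _ _ R mu
      (fun p : R * R => `|(f (t - p.1) * (g (p.1 - p.2) * h p.2))%:E|%E).
    by apply => //; exact: measurableT_comp.
  - exact: emeasurable_funM.
  move=> s _ /=.
  have mg : measurable_fun setT (fun r : R => (gker b (s - r) * gker c r)%:E).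
    by apply/measurable_EFinP; apply: measurable_mul_shift; exact: measurable_gker.
  rewrite [X in (_ <= _ * X%:E)%E]normrM (ger0_norm (gker_ge0 _ bc0)).
  rewrite -EFinM mulrA EFinM -gker_cconv// -ge0_integralZl//; last 2 first.
  - by move=> r _; rewrite lee_fin gker_mul_ge0.
  - by rewrite lee_fin mulr_ge0.
  apply: ge0_le_integral => //.
  - apply/measurable_EFinP; apply: measurableT_comp => //; apply: measurable_funM => //.
    by apply: measurable_mul_shift; exact: adm_measurable.
  - exact: emeasurable_funM.
  move=> r _; rewrite -EFinM lee_fin normrM [C * _]mulrC -mulrA.
  have [st|st] := leP s t; first by rewrite ler_wpM2l// ghC.
  by rewrite (adm_le0 fa) ?normr0 ?mul0r// subr_le0 ltW.
rewrite ge0_integralZl// lte_mul_pinfty//.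
by have /integrableP[_] := fi.
Qed.

Lemma integrable_shift f t : mu.-integrable setT (EFin \o f) ->
  mu.-integrable setT (EFin \o (fun s => f (s + t))).
Proof.
move=> /integrableP[mf fi]; apply/integrableP; split.
  by apply: (measurableT_comp mf); exact: measurable_funD.
have := @ge0_integral_shift R t _ (measurableT_comp (@abse_measurable R setT) mf).
by move=> /(_ (fun=> abse_ge0 _)) <-.
Qed.

(** Both sides are iterated integrals of f (t - s) g (s - r) h r; on the right, translating the
    inner variable by [r] brings the integrand to this form. *)
Lemma cconvA f g h : admissible f -> admissible g -> admissible h ->
  cconv f (cconv g h) = cconv (cconv f g) h.
Proof.
move=> fa ga ha; apply/funext => t.
have := Fubini (integrable_cconv3 t fa ga ha); rewrite /fubini_F /fubini_G /= => FE.
have LE s : ((f (t - s) * cconv g h s)%:E = \int[mu]_r (f (t - s) * (g (s - r) * h r))%:E)%E.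
  rewrite cconv.unlock -RintegralZl ?EFin_Rintegral//; last exact: cconv_integrable.
  rewrite (_ : EFin \o _ = fun r => ((f (t - s))%:E * (g (s - r) * h r)%:E)%E); last first.
    by apply/funext => r; rewrite -EFinM.
  by apply: integrableZl => //; exact: cconv_integrable.
have RE r : ((cconv f g (t - r) * h r)%:E = \int[mu]_s (f (t - s) * (g (s - r) * h r))%:E)%E.
  have fgi : mu.-integrable setT (EFin \o (fun s => f (t - s) * g (s - r))).
    have := integrable_shift (- r) (cconv_integrable (t - r) fa ga).
    by apply: eq_integrable => // s _ /=; rewrite opprB addrA subrK.
  have -> : cconv f g (t - r) = \int[mu]_s (f (t - s) * g (s - r)).
    rewrite cconv.unlock (Rintegral_shift (- r)); last exact: cconv_integrable.
    by apply: eq_Rintegral => s _; rewrite opprB addrA subrK.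
  rewrite -RintegralZr// EFin_Rintegral//.
    by apply: eq_integral => s _; rewrite mulrA.
  rewrite (_ : EFin \o _ = fun s => ((f (t - s) * g (s - r))%:E * (h r)%:E)%E); last first.
    by apply/funext => s; rewrite -EFinM.
  by apply: integrableZr.
have -> : cconv f (cconv g h) t = fine (\int[mu]_s (f (t - s) * cconv g h s)%:E).
  by rewrite {1}cconv.unlock.
have -> : cconv (cconv f g) h t = fine (\int[mu]_r (cconv f g (t - r) * h r)%:E).
  by rewrite {1}cconv.unlock.
by under eq_integral do rewrite LE; under [in RHS]eq_integral do rewrite RE; rewrite FE.
Qed.

Lemma cconv1_patch f t s : admissible f -> gker 1 (t - s) * f s = (f \_ `]0, t[) s.
Proof.
move=> fa; rewrite patchE; case: ifPn => [|/negP].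
  by rewrite inE/= in_itv/= => /andP[s0 st]; rewrite gker1 ?mul1r// subr_gt0.
rewrite inE/= in_itv/= => /negP; rewrite negb_and -!leNgt => /orP[s0|ts].
  by rewrite (adm_le0 fa) ?mulr0.
by rewrite gker_le0 ?mul0r// subr_le0.
Qed.

Lemma adm_integrable_oo f t : admissible f -> mu.-integrable `]0, t[ (EFin \o f).
Proof.
move=> fa; apply/(integrable_mkcond _ _).2 => //.
have := cconv_integrable t (adm_gker ltr01) fa.
apply: eq_integrable => // s _ /=; rewrite cconv1_patch//.
by rewrite !patchE; case: ifP.
Qed.

Lemma adm_integrable f t : admissible f -> mu.-integrable `]0, t] (EFin \o f).
Proof.
move=> fa; apply: integrableS (adm_integrable_oo (t + 1) fa) => //.
by apply: subset_itvl; rewrite bnd_simp ltrDl.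
Qed.

Lemma cconv1E f t : admissible f -> cconv (gker 1) f t = \int[mu]_(s in `]0, t]) f s.
Proof.
move=> fa; rewrite -Rintegral_itv_bndo_bndc; last exact: adm_integrable_oo.
by rewrite cconv.unlock [RHS]Rintegral_mkcond; apply: eq_Rintegral => s _; rewrite cconv1_patch.
Qed.

Lemma is_derive_cconv1 f t : admissible f -> 0 < t ->
  is_derive t 1 (cconv (gker 1) f) (f t).
Proof.
move=> fa t0.
have tt1 : t < t + 1 by rewrite ltrDl.
have t0' : (BRight 0 < BRight t)%O by rewrite bnd_simp.
have [] := @continuous_FTC1 R f (BRight 0) t (t + 1) tt1 (adm_integrable _ fa) t0' (fa.1 t t0).
rewrite (_ : (fun y => _) = cconv (gker 1) f); last by apply/funext => y; rewrite cconv1E.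
by move=> df fE; apply: (DeriveDef df); rewrite -derive1E.
Qed.

(** Even if [f] blows up at 0, integration raises its exponent from a to 1 + a, leaving a bound by a
    multiple of t^a with a > 0. *)
Lemma cconv1_cvg0 f : admissible f -> cconv (gker 1) f t @[t --> 0^'+] --> 0.
Proof.
move=> fa; have [_ [a a0 fb]] := fa; have ga := adm_gker (@ltr01 R).
have gb : kerbound 1 (gker 1).
  by move=> T; exists 1 => t _; rewrite mul1r ger0_norm// gker_ge0.
have [C CE] := cconv_bound ltr01 a0 ga fa gb fb 1.
apply/norm_cvg0P.
apply: (@squeeze_cvgr _ _ _ _ (fun=> 0) (fun t => C / Gamma_fun (1 + a) * t `^ a)).
- near=> t; rewrite normr_ge0/=.
  have t0 : 0 < t by near: t; exact: nbhs_right_gt.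
  have t1 : t <= 1 by near: t; exact: nbhs_right_le.
  apply: (le_trans (CE _ t1)); rewrite gker.unlock pospowE//.
  by rewrite (_ : 1 + a - 1 = a); [rewrite mulrA mulrAC|ring].
- exact: cvg_cst.
- have := cvgM (cvg_cst (C / Gamma_fun (1 + a))) (powR_cvg0 a0).
  by rewrite mulr0; exact.
Unshelve. all: by end_near. Qed.

End convolution.

(** * Mittag-Leffler kernels *)

Section entire_series.
Context {R : realType}.
Implicit Types (u : R^nat) (x A C : R).

(* Faster than geometric decay, i.e. infinite radius of convergence. *)
Definition rapid u :=
  forall A, 0 < A -> exists2 C, 0 <= C & forall k, `|u k| <= C * A ^- k.

Lemma rapid_norm u : rapid u -> rapid (fun k => `|u k|).
Proof.
move=> ru A A0; have [C C0 uC] := ru A A0.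
by exists C => // k; rewrite normr_id.
Qed.

Lemma rapid_diffs u : rapid u -> rapid (pseries_diffs u).
Proof.
(* Decay at the rate [2 * A] leaves a spare 2^k to absorb the factor k + 1 of the formal
   derivative. *)
move=> ru A A0; have [|C C0 uC] := ru (2 * A); first by rewrite mulr_gt0.
exists (C * (2 * A)^-1).
  by rewrite mulr_ge0// invr_ge0 mulr_ge0// ltW.
move=> k; rewrite /pseries_diffs normrM ger0_norm//.
have k2 : k.+1%:R <= 2 ^+ k :> R by rewrite -natrX ler_nat ltn_expl.
rewrite (@le_trans _ _ (2 ^+ k * (C * (2 * A) ^- k.+1)))//.
  by apply: ler_pM.
rewrite exprS invfM [leLHS]mulrCA -!mulrA.
rewrite (_ : 2 ^+ k * _ = (2 * A)^-1 * A ^- k)//.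
rewrite exprMn; have : 2 ^+ k != 0 :> R by rewrite expf_neq0// pnatr_eq0.
have : A ^+ k != 0 by rewrite expf_neq0// gt_eqF.
have : 2 * A != 0 by rewrite mulf_neq0// ?gt_eqF.
by move: (2 * A) (A ^+ k) (2 ^+ k) => p q r p0 q0 r0; field; rewrite p0 q0 r0.
Qed.

Lemma rapid_cvg u x : rapid u -> cvgn (pseries u x).
Proof.
move=> ru; have x0 : 0 < `|x| + 1 by rewrite ltr_wpDl.
have [C C0 uC] := ru _ x0.
apply: normed_cvg; rewrite /normed_series_of /=.
apply: (@series_le_cvg _ _ (geometric C (`|x| / (`|x| + 1)))) => //.
- by move=> n; rewrite /geometric/= mulr_ge0// exprn_ge0// divr_ge0// ltW.
- move=> n /=; rewrite normrM normrX expr_div_n mulrA mulrAC.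
  by rewrite ler_wpM2r// exprn_ge0.
- apply: is_cvg_geometric_series; rewrite ger0_norm ?divr_ge0// ?ltW//.
  by rewrite ltr_pdivrMr// mul1r ltrDl.
Qed.

(** Continuity comes from termwise differentiation, whose criterion asks that the series and its
    first two formal derivatives converge at a point beyond |x|. *)
Lemma rapid_continuous u : rapid u -> continuous (fun x => limn (pseries u x)).
Proof.
move=> ru x.
have c1 := rapid_diffs ru; have c2 := rapid_diffs c1.
have [|df _] := @pseries_snd_diffs R u (`|x| + 1) x (rapid_cvg (x := _) ru)
  (rapid_cvg (x := _) c1) (rapid_cvg (x := _) c2).
  by rewrite [ltRHS]ger0_norm ?addr_ge0// ltrDl.
by apply: differentiable_continuous; apply/derivable1_diffP.
Qed.

Lemma rapid_bound u x (r : R) n : rapid u -> `|x| <= r ->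
  `|pseries u x n| <= limn (pseries (fun k => `|u k|) r).
Proof.
move=> ru xr; have r0 := le_trans (normr_ge0 x) xr.
apply: (@le_trans _ _ (pseries (fun k => `|u k|) r n)).
  rewrite /pseries /series/= (le_trans (ler_norm_sum _ _ _))// ler_sum// => k _.
  by rewrite normrM normrX ler_wpM2l// lerXn2r// nnegrE.
apply: nondecreasing_cvgn_le; last exact: rapid_cvg (rapid_norm ru).
apply/nondecreasing_seqP => k; rewrite /pseries /series/= big_nat_recr//= lerDl.
by rewrite mulr_ge0// exprn_ge0.
Qed.

End entire_series.

HB.lock Definition mlker {R : realType} (gamma c b t : R) : R :=
  pospow b t * mittag_leffler gamma b (c * t `^ gamma).

Section mittag_leffler_kernels.
Context {R : realType}.
Local Notation mu := (@lebesgue_measure R).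
Variables (gamma c : R).
Hypothesis gamma_gt0 : 0 < gamma.
Implicit Types (a b s t T : R).
Local Notation E := (mlker gamma c).

Definition ml_coef b (k : nat) : R := (Gamma_fun (gamma * k%:R + b))^-1.

Lemma ml_index_gt0 b k : 0 < b -> 0 < gamma * k%:R + b.
Proof. by move=> b0; rewrite ltr_wpDl// mulr_ge0// ltW. Qed.

Lemma mittag_lefflerE b z : mittag_leffler gamma b z = limn (pseries (ml_coef b) z).
Proof.
rewrite /mittag_leffler /pseries.
by congr (limn (series _)); apply/funext => k; rewrite mulrC.
Qed.

Lemma rapid_ml b : 0 < b -> rapid (ml_coef b).
Proof.
(* With this base, B^(gamma k + b) = A^k B^b, so the lower bound on Gamma at [B] grows like A^k. *)
move=> b0 A A0; pose B := A `^ gamma^-1.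
have B0 : 0 < B by rewrite powR_gt0.
pose D := expR (- (B + 1)) / (B + 1).
have D0 : 0 < D by rewrite divr_gt0 ?expR_gt0// addr_gt0.
have BD0 : 0 < B `^ b * D by rewrite mulr_gt0// powR_gt0.
exists (B `^ b * D)^-1; first by rewrite invr_ge0 ltW.
move=> k; have k0 := ml_index_gt0 k b0.
rewrite /ml_coef normfV gtr0_norm ?Gamma_fun_gt0// -invfM.
rewrite lef_pV2 ?posrE ?Gamma_fun_gt0//; last by rewrite mulr_gt0// exprn_gt0.
apply: le_trans (Gamma_fun_ge k0 B0).
have BA : B `^ gamma = A.
  rewrite /B -powRrM mulVf; last by rewrite gt_eqF.
  by rewrite powRr1// ltW.
rewrite powRD ?(gt_eqF B0) ?implybT// powRrM BA powR_mulrn; last exact: ltW.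
by rewrite -/D -mulrA mulrC.
Qed.

(** Partial sums of the kernel [mlker], arranged as combinations of Riemann-Liouville kernels so
    that convolution acts termwise by adding indices. *)
Definition mlsum b n t : R := \sum_(0 <= k < n) c ^+ k * gker (gamma * k%:R + b) t.

Lemma mlsumE b n t : mlsum b n t = pospow b t * pseries (ml_coef b) (c * t `^ gamma) n.
Proof.
rewrite /mlsum /pseries /series/= mulr_sumr; apply: eq_bigr => k _.
have [t0|t0] := ltP 0 t; last by rewrite gker_le0// pospow_le0// mulr0 mul0r.
rewrite gker.unlock /ml_coef !pospowE//.
rewrite (_ : gamma * k%:R + b - 1 = (b - 1) + gamma * k%:R); last by ring.
rewrite powRD ?(gt_eqF t0) ?implybT// powRrM powR_mulrn ?powR_ge0// exprMn.
by move: (Gamma_fun _)^-1 => G; ring.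
Qed.

Lemma mlsum_cvg b t : 0 < b -> mlsum b n t @[n --> \oo] --> E b t.
Proof.
move=> b0; under eq_fun do rewrite mlsumE.
rewrite mlker.unlock mittag_lefflerE.
exact: (cvgM (cvg_cst (pospow b t)) (rapid_cvg (x := _) (rapid_ml b0))).
Qed.

(** One constant serves all [n]: the bound survives in the limit, and it dominates the partial sums
    under the integral sign. *)
Lemma mlsum_bound b T : 0 < b -> exists2 C, 0 <= C &
  forall n t, t <= T -> `|mlsum b n t| <= C * gker b t.
Proof.
move=> b0; have rb := rapid_ml b0.
pose M := limn (pseries (fun k => `|ml_coef b k|) (`|c| * T `^ gamma)).
have M0 : 0 <= M.
  have := @rapid_bound R (ml_coef b) 0 (`|c| * T `^ gamma) 0 rb.
  by rewrite normr0 mulr_ge0 ?powR_ge0// => /(_ isT); exact: le_trans.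
exists (M * Gamma_fun b); first by rewrite mulr_ge0// ltW// Gamma_fun_gt0.
move=> n t tT; have [t0|t0] := ltP 0 t; last first.
  by rewrite mlsumE pospow_le0// mul0r normr0 gker_le0// mulr0.
rewrite mlsumE normrM (ger0_norm (pospow_ge0 _ _)) gker.unlock.
have /gt_eqF/negbT G0 := Gamma_fun_gt0 b0.
rewrite [leRHS]mulrCA -mulrA mulfV// mulr1.
apply: ler_wpM2l; first exact: pospow_ge0.
apply: rapid_bound => //; rewrite normrM ler_wpM2l// ger0_norm ?powR_ge0//.
by apply: ge0_ler_powR => //; rewrite ?nnegrE; [exact: ltW|exact: ltW|exact: le_trans (ltW t0) tT].
Qed.

Lemma adm_mlker b : 0 < b -> admissible (E b).
Proof.
move=> b0; split.
  move=> t t0.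
  have cz : (c * s `^ gamma) @[s --> t] --> c * t `^ gamma.
    exact: (cvgM (cvg_cst c) (@continuous_powR _ gamma t t0)).
  have cm : mittag_leffler gamma b (c * s `^ gamma) @[s --> t] -->
            mittag_leffler gamma b (c * t `^ gamma).
    under eq_fun do rewrite mittag_lefflerE.
    rewrite mittag_lefflerE.
    exact: (cvg_comp _ _ cz (@rapid_continuous _ _ (rapid_ml b0) (c * t `^ gamma))).
  have cp : pospow b s @[s --> t] --> pospow b t.
    have := (adm_gker b0).1 t t0.
    have gc : gker b s @[s --> t] --> gker b t by exact: (adm_gker b0).1 t t0.
    have /gt_eqF/negbT G0 := Gamma_fun_gt0 b0.
    have pE s : Gamma_fun b * gker b s = pospow b s by rewrite gker.unlock mulrC divfK.
    have : Gamma_fun b * gker b s @[s --> t] --> Gamma_fun b * gker b t.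
      exact: (cvgM (cvg_cst _) gc).
    by rewrite pE; under eq_fun do rewrite pE.
  by rewrite mlker.unlock; exact: (cvgM cp cm).
exists b => // T; have [C C0 bC] := mlsum_bound T b0; exists C => t tT.
have h : `|mlsum b n t| @[n --> \oo] --> `|E b t|.
  exact: (cvg_norm (@mlsum_cvg _ t b0)).
rewrite -(cvg_lim _ h)//; apply: limr_le; first by apply/cvg_ex; eexists; exact: h.
by apply: nearW => n; exact: bC.
Qed.

(** The term k = 0 of the series is split off; reindexing the others by k + 1 releases one factor
    [c] and adds [gamma] to the index. *)
Lemma mlker_rec b : 0 < b -> E b = gker b \+ c \*o E (b + gamma).
Proof.
move=> b0; apply/funext => t /=.
have bg0 : 0 < b + gamma by rewrite addr_gt0.
have h1 : mlsum b n.+1 t @[n --> \oo] --> E b t.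
  by rewrite (cvg_shiftS (mlsum b ^~ t)); exact: mlsum_cvg.
have h2 : (gker b t + c * mlsum (b + gamma) n t) @[n --> \oo] -->
          gker b t + c * E (b + gamma) t.
  exact: (cvgD (cvg_cst _) (cvgM (cvg_cst c) (@mlsum_cvg _ t bg0))).
have En n : mlsum b n.+1 t = gker b t + c * mlsum (b + gamma) n t.
  rewrite /mlsum big_nat_recl//= expr0 mul1r mulr0 add0r; congr (_ + _).
  rewrite mulr_sumr; apply: eq_bigr => k _; rewrite exprS -mulrA.
  by congr (_ * (_ * gker _ _)); rewrite -natr1; ring.
rewrite -(cvg_lim _ h1)//; apply/cvg_lim => //.
by under eq_fun do rewrite En.
Qed.

Lemma adm0 : admissible (fun _ : R => 0 : R).
Proof.
split; first by move=> t _; exact: cvg_cst.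
by exists 1 => // T; exists 0 => t _; rewrite normr0 mul0r.
Qed.

Lemma adm_mlsum b n : 0 < b -> admissible (mlsum b n).
Proof.
move=> b0; elim: n => [|n IHn].
  rewrite (_ : mlsum b 0 = fun=> 0); first exact: adm0.
  by apply/funext => t; rewrite /mlsum big_nil.
rewrite (_ : mlsum b n.+1 = mlsum b n \+ c ^+ n \*o gker (gamma * n%:R + b)).
  by apply: admD => //; apply: admZ; apply: adm_gker; exact: ml_index_gt0.
by apply/funext => t; rewrite /mlsum big_nat_recr.
Qed.

Lemma cconv_gker_mlsum a b n : 0 < a -> 0 < b ->
  cconv (gker a) (mlsum b n) = mlsum (a + b) n.
Proof.
move=> a0 b0; have ga := adm_gker a0.
elim: n => [|n IHn].
  apply/funext => t; rewrite cconv.unlock /mlsum big_nil.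
  by under eq_Rintegral do rewrite big_nil mulr0; rewrite Rintegral_cst// mul0r.
have i0 := ml_index_gt0 n b0; have gi := adm_gker i0.
rewrite (_ : mlsum b n.+1 = mlsum b n \+ c ^+ n \*o gker (gamma * n%:R + b)).
  rewrite cconvDr ?cconvZr ?IHn ?cconv_gker//; [|exact: adm_mlsum|exact: admZ].
  apply/funext => t; rewrite /mlsum big_nat_recr /=; last by [].
  by rewrite addrCA.
by apply/funext => t; rewrite /mlsum big_nat_recr.
Qed.

(** The identity is exact on partial sums, and dominated convergence carries it to the limit. *)
Lemma cconv_gker_mlker a b : 0 < a -> 0 < b -> cconv (gker a) (E b) = E (a + b).
Proof.
move=> a0 b0; apply/funext => t.
have ab0 := addr_gt0 a0 b0; have ga := adm_gker a0; have ea := adm_mlker b0.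
have [C C0 SC] := mlsum_bound t b0.
have Si n := cconv_integrable t ga (adm_mlsum n b0).
have mS n := measurable_int _ (Si n).
have mE := measurable_int _ (cconv_integrable t ga ea).
have iD : mu.-integrable setT (fun s => (C * (gker a (t - s) * gker b s))%:E).
  have -> : (fun s => (C * (gker a (t - s) * gker b s))%:E) =
            (fun s => C%:E * (gker a (t - s) * gker b s)%:E)%E.
    by apply/funext => s; rewrite EFinM.
  by apply: integrableZl => //; exact: integrable_gker_cconv.
have cS : {ae mu, forall s, setT s ->
    (EFin \o (fun s => gker a (t - s) * mlsum b n s)) s @[n --> \oo] -->
    (EFin \o (fun s => gker a (t - s) * E b s)) s}.
  apply: aeW => s _; apply: cvg_EFin; first exact: nearW.
  exact: (cvgM (cvg_cst _) (@mlsum_cvg _ s b0)).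
have dS : {ae mu, forall s n, setT s ->
    (`|(gker a (t - s)%R * mlsum b n s)%:E| <=
       (C * (gker a (t - s)%R * gker b s))%:E)%E}.
  apply: aeW => s n _; rewrite lee_fin normrM (ger0_norm (gker_ge0 _ a0)) mulrCA.
  have [st|st] := leP s t.
    by apply: ler_wpM2l; [exact: gker_ge0|exact: SC].
  by rewrite gker_le0 ?mul0r// subr_le0 ltW.
have [_ _ H] := dominated_convergence measurableT mS mE cS iD dS.
rewrite -(cvg_lim _ (@mlsum_cvg _ t ab0))//; apply/esym/cvg_lim => //.
under eq_fun do rewrite -cconv_gker_mlsum//.
rewrite cconv.unlock; apply: fine_cvg.
rewrite fineK; last exact: integrable_fin_num (cconv_integrable t ga ea).
exact: H.
Qed.

End mittag_leffler_kernels.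

(** * Relative derivatives *)

Section relative_derivatives.
Context {R : realType}.
Local Notation mu := (@lebesgue_measure R).
Implicit Types (f g : R -> R) (t l T : R) (D : set R).

Lemma near_dnbhs_shift t (P : set R) :
  (\forall s \near t^', P s) <-> (\forall h \near 0^', P (h + t)).
Proof.
have H := near_shift 0 t (fun s => s != t -> P s); rewrite /= subr0 in H.
have -> : (\forall s \near t^', P s) = (\forall z \near 0, z + t != t -> P (z + t)) by exact: H.
have -> : (\forall h \near 0^', P (h + t)) = (\forall z \near (0 : R), z != 0 -> P (z + t)) by [].
split; apply: filterS => h /=.
  by move=> Ph h0; apply: Ph; rewrite -subr_eq0 addrK.
by move=> Ph h0; apply: Ph; move: h0; rewrite -subr_eq0 addrK.
Qed.

Lemma cvg_diff_quot_derive f t l :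
  diff_quot f t s @[s --> t^'] --> l <->
  h^-1 *: ((f \o shift t) (h *: (1 : R)) - f t) @[h --> 0^'] --> l.
Proof.
have E h : diff_quot f t (h + t) = h^-1 *: ((f \o shift t) (h *: (1 : R)) - f t).
  by rewrite /diff_quot /= addrK scaler1 mulrC.
split=> /cvgrPdist_lt H; apply/cvgrPdist_lt => e /H.
  by move/near_dnbhs_shift; apply: filterS => h; rewrite E.
by move=> H'; apply/near_dnbhs_shift; move: H'; apply: filterS => h; rewrite E.
Qed.

Lemma cvg_diff_quot_within f D t l :
  diff_quot f t s @[s --> t^'] --> l -> diff_quot f t s @[s --> within D t^'] --> l.
Proof. by apply: cvg_trans; apply: cvg_app; exact: cvg_within. Qed.

Lemma cvg_diff_quot_eq f g D t l : D t -> {in D, f =1 g} ->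
  diff_quot f t s @[s --> within D t^'] --> l ->
  diff_quot g t s @[s --> within D t^'] --> l.
Proof.
move=> Dt fg; apply: cvg_trans; apply: near_eq_cvg.
rewrite near_withinE; apply: nearW => s Ds.
by rewrite /diff_quot !fg// inE.
Qed.

(** Uniqueness of the limit in [derive_on] rests on this. The points approaching [t] are taken on
    its left, which works at the endpoint T as well. *)
Lemma within_itv_left_proper T t : 0 < t <= T -> ProperFilter (within `]0, T] t^').
Proof.
move=> /andP[t0 tT]; split; last exact: within_filter.
rewrite /within/= => /nbhs_ballP[e /= e0].
pose d := Num.min e t / 2.
have m0 : 0 < Num.min e t by rewrite lt_min e0.
have d0 : 0 < d by rewrite divr_gt0.
have de : d < e.
  by rewrite (@lt_le_trans _ _ (Num.min e t)) ?ge_min ?lexx// ltr_pdivrMr// ltr_pMr// ltr1n.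
have dt : d < t.
  by rewrite (@lt_le_trans _ _ (Num.min e t)) ?ge_min ?lexx ?orbT// ltr_pdivrMr// ltr_pMr// ltr1n.
move=> /(_ (t - d)); apply.
- by rewrite /ball/= opprB addrCA subrr addr0 gtr0_norm.
- by rewrite -subr_eq0 addrAC subrr add0r oppr_eq0 gt_eqF.
- by rewrite /= in_itv/= subr_gt0 dt/= lerBlDr ler_wpDr// ltW.
Qed.

(** [f] need not behave well past [T]: its relative derivative, one-sided at [T], is inherited from
    the two-sided derivative of [g]. *)
Lemma derive_on_eq f g T t l : 0 < t <= T -> {in `]0, T]%classic, f =1 g} ->
  is_derive t 1 g l ->
  cvg (diff_quot f t s @[s --> within `]0, T] t^']) /\ derive_on `]0, T] f t = l.
Proof.
move=> tT fg gl.
have Dt : `]0, T]%classic t by rewrite /= in_itv.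
have H : diff_quot f t s @[s --> within `]0, T] t^'] --> l.
  apply: (@cvg_diff_quot_eq g) => //; first by move=> x /fg.
  apply/cvg_diff_quot_within/cvg_diff_quot_derive.
  by have [dg <-] := gl; exact: dg.
split; first by apply/cvg_ex; exists l.
by have := within_itv_left_proper tT => PF; apply: cvg_lim.
Qed.

Lemma cvg_diff_quot_continuous f D t :
  cvg (diff_quot f t s @[s --> within D t^']) -> f s @[s --> within D t^'] --> f t.
Proof.
move=> /cvg_ex[l dl].
have st : (s - t) @[s --> within D t^'] --> (t - t).
  apply: cvgB; last exact: cvg_cst.
  by apply: cvg_trans; [exact: cvg_within|exact: cvg_within].
have H := cvgD (cvg_cst (f t)) (cvgM dl st).
have {H} : f t + diff_quot f t s * (s - t) @[s --> within D t^'] --> f t + l * (t - t) by exact: H.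
rewrite subrr mulr0 addr0; apply: cvg_trans; apply: near_eq_cvg.
rewrite !near_withinE; apply: nearW => s st0 _.
by rewrite /diff_quot divfK ?subr_eq0// addrC subrK.
Qed.

Lemma min_extension_continuous f T t : 0 < T -> {within `[0, T], continuous f} -> 0 < t ->
  f (Num.min x T) @[x --> t] --> f (Num.min t T).
Proof.
move=> T0 fc t0.
have mA x : 0 < x -> `[0, T]%classic (Num.min x T).
  by move=> x0; rewrite /= in_itv/= le_min ltW//= ltW//= ge_min lexx orbT.
have /subspace_continuousP/(_ _ (mA _ t0)) fp := fc.
have mc : Num.min x T @[x --> t] --> Num.min t T.
  exact: (continuous_min cvg_id (cvg_cst T)).
apply: (cvg_comp _ _ _ fp).
move=> U /=; rewrite /within/= => HU.
have H : \forall x \near t, `[0, T]%classic (Num.min x T) -> U (Num.min x T) by exact: mc _ HU.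
have Hp : \forall x \near t, 0 < x := lt_nbhsr t0.
by apply: filterS2 Hp H => x x0; apply; exact: mA.
Qed.

(** The witness [g] is the derivative of [f], frozen at its value at [T] from there on and zero for
    t <= 0. Its extreme values on [0, T] bound it, so exponent 1 works, [gker 1] being 1 on the
    positive reals. *)
Lemma C1_on_primitive f T : 0 < T -> C1_on `[0, T] f ->
  exists2 g, admissible g & forall t, 0 < t <= T -> f t = f 0 + cconv (gker 1) g t.
Proof.
move=> T0 [df dc]; set d := derive_on `[0, T] f in dc *.
pose g t := if 0 < t then d (Num.min t T) else 0.
have ga : admissible g.
  split.
    move=> t t0; have -> : {for t, continuous g} = (g x @[x --> t] --> g t) by [].
    rewrite {2}/g t0; apply: cvg_trans (min_extension_continuous T0 dc t0).
    apply: near_eq_cvg; near=> x; rewrite /g ifT//; near: x; exact: lt_nbhsr.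
  exists 1 => // T'.
  have [c1 _ h1] := EVT_max (ltW T0) dc; have [c2 _ h2] := EVT_min (ltW T0) dc.
  exists (`|d c1| + `|d c2|) => t _; rewrite /g; case: ifPn => t0; last first.
    by rewrite normr0 gker_le0 ?mulr0// leNgt.
  rewrite gker1// mulr1.
  have mi : Num.min t T \in `[0, T].
    by rewrite in_itv/= le_min ltW//= ltW//= ge_min lexx orbT.
  rewrite ler_norml; apply/andP; split.
    apply: le_trans (h2 _ mi); rewrite opprD -[leRHS]add0r lerD ?oppr_le0//.
    by rewrite lerNl ler_normr lexx orbT.
  apply: le_trans (h1 _ mi) _; rewrite -[leLHS]addr0 lerD//.
  exact: ler_norm.
exists g => // t /andP[t0 tT].
have subT : `[0, t] `<=` `[0, T] by apply: subset_itvl; rewrite bnd_simp.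
have dct : {within `[0, t], continuous d} by apply: continuous_subspaceW dc.
have fint x : 0 < x < t -> is_derive x 1 f (d x).
  move=> /andP[x0 xt].
  have Dx : `[0, T]%classic x by rewrite /= in_itv/= ltW//= (le_trans (ltW xt)).
  have := df _ Dx => cx.
  have : diff_quot f x s @[s --> within `[0, T] x^'] --> d x by exact: cx.
  (* At an interior point the restriction to [0, T] is invisible, so the relative derivative is the
     usual one. *)
  have -> : within `[0, T] x^' = x^'.
    apply/seteqP; split=> U; last by apply: cvg_within.
    have Ix : \forall s \near x^', `[0, T]%classic s.
      apply: cvg_within; near=> s; rewrite /= in_itv/=; apply/andP; split.
        by near: s; exact: lt_le_nbhsr.
      by rewrite (le_trans _ tT)//; near: s; exact: lt_le_nbhsl.
    by move=> UH; apply: filterS2 Ix UH => s Ds; exact.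
  move/cvg_diff_quot_derive => H.
  by apply: DeriveDef; [apply/cvg_ex; exists (d x); exact: H|exact: cvg_lim H].
have fwith x : 0 <= x <= T -> f s @[s --> within `[0, T] x^'] --> f x.
  by move=> xT; apply: cvg_diff_quot_continuous; apply: df; rewrite /= in_itv.
have dLR : derivable_oo_LRcontinuous f 0 t.
  split.
  - by move=> x; rewrite in_itv/= => /fint[].
  - apply: cvg_trans (fwith 0 _); last by rewrite lexx ltW.
    apply: cvg_app => U HU.
    have HU' : \forall s \near (0 : R), s != 0 -> `[0, T]%classic s -> U s by exact: HU.
    have Hp : \forall s \near (0 : R), s <= T by exact: lt_le_nbhsl.
    suff : \forall s \near (0 : R), 0 < s -> U s by [].
    apply: filterS2 Hp HU' => s sT h s0.
    by apply: h; rewrite ?gt_eqF//= in_itv/= (ltW s0) sT.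
  - apply: cvg_trans (fwith t _); last by rewrite (ltW t0).
    apply: cvg_app => U HU.
    have HU' : \forall s \near t, s != t -> `[0, T]%classic s -> U s by exact: HU.
    have Hp : \forall s \near t, 0 <= s by exact: lt_le_nbhsr.
    suff : \forall s \near t, s < t -> U s by [].
    apply: filterS2 Hp HU' => s s0 h st.
    by apply: h; rewrite ?lt_eqF//= in_itv/= s0 (le_trans (ltW st)).
have dE : {in `]0, t[, f^`()%classic =1 d}.
  by move=> x; rewrite in_itv/= => /fint[_ <-]; rewrite derive1E.
have := continuous_FTC2 t0 dct dLR dE.
rewrite cconv1E// => H.
have -> : \int[mu]_(s in `]0, t]) g s = \int[mu]_(s in `[0, t]) d s.
  rewrite -Rintegral_itv_obnd_cbnd.
    apply: eq_Rintegral => s; rewrite inE/= in_itv/= => /andP[s0 st].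
    by rewrite /g s0 min_l// (le_trans st).
  have := adm_integrable t ga; apply: eq_integrable => // s.
  rewrite inE/= in_itv/= => /andP[s0 st].
  by rewrite /g s0 min_l// (le_trans st).
by rewrite /Rintegral H -EFinB/= addrCA subrr addr0.
Unshelve. all: by end_near. Qed.

End relative_derivatives.

(** * Fractional integrals *)

Section fractional_integral.
Context {R : realType}.
Local Notation mu := (@lebesgue_measure R).
Implicit Types (a b s t T : R) (f g h w : R -> R).

(** Order 0 is a separate case because no kernel function is a unit for convolution; it occurs at
    both extreme types, delta = 0 and delta = 1. *)
Definition frac_int a f : R -> R := if a == 0 then f else cconv (gker a) f.

Lemma frac_intD a f g : 0 <= a -> admissible f -> admissible g ->
  frac_int a (f \+ g) = frac_int a f \+ frac_int a g.
Proof.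
rewrite le_eqVlt /frac_int => /predU1P[<-|a0] fa ga; first by rewrite eqxx.
by rewrite gt_eqF// cconvDr//; exact: adm_gker.
Qed.

Lemma frac_intZ a k f : 0 <= a -> admissible f ->
  frac_int a (k \*o f) = k \*o frac_int a f.
Proof.
rewrite le_eqVlt /frac_int => /predU1P[<-|a0] fa; first by rewrite eqxx.
by rewrite gt_eqF// cconvZr//; exact: adm_gker.
Qed.

Lemma frac_int_cconv a f g : 0 <= a -> admissible f -> admissible g ->
  frac_int a (cconv f g) = cconv (frac_int a f) g.
Proof.
rewrite le_eqVlt /frac_int => /predU1P[<-|a0] fa ga; first by rewrite eqxx.
by rewrite gt_eqF// cconvA//; exact: adm_gker.
Qed.

Lemma frac_int_mlker gamma c a b : 0 < gamma -> 0 <= a -> 0 < b ->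
  frac_int a (mlker gamma c b) = mlker gamma c (a + b).
Proof.
move=> g0; rewrite le_eqVlt /frac_int => /predU1P[<-|a0] b0.
  by rewrite eqxx add0r.
by rewrite gt_eqF// cconv_gker_mlker.
Qed.

(** Bridge from the integrals over ]0, t[ of the problem to those over the line: [w] is only
    evaluated where it agrees with [g], and elsewhere the product on the right vanishes by
    itself. *)
Lemma cconv_patch f g w t T s : admissible f -> admissible g -> t <= T ->
  {in `]0, T]%classic, w =1 g} ->
  ((fun s => f (t - s) * w s) \_ `]0, t[) s = f (t - s) * g s.
Proof.
move=> fa ga tT wg; rewrite patchE; case: ifPn => [|/negP].
  rewrite inE/= in_itv/= => /andP[s0 st].
  by rewrite wg// inE/= in_itv/= s0 (le_trans (ltW st)).
rewrite inE/= in_itv/= => /negP; rewrite negb_and -!leNgt => /orP[s0|ts].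
  by rewrite (adm_le0 ga) ?mulr0.
by rewrite (adm_le0 fa) ?mul0r// subr_le0.
Qed.

Lemma powR_gker a s t w : 0 < a -> s < t ->
  (t - s) `^ (a - 1) * w s = Gamma_fun a * (gker a (t - s) * w s).
Proof.
move=> a0 st; rewrite gker.unlock pospowE ?subr_gt0//.
by rewrite mulrA [Gamma_fun a * _]mulrC divfK// gt_eqF// Gamma_fun_gt0.
Qed.

Lemma RL_integrable_adm a f w t T : 0 <= a -> admissible f -> 0 < t <= T ->
  {in `]0, T]%classic, w =1 f} -> RL_integrable a w t.
Proof.
rewrite le_eqVlt => /predU1P[<-|a0] fa /andP[t0 tT] wf; first by rewrite /RL_integrable eqxx.
move=> _; have ga := adm_gker a0.
have : mu.-integrable `]0, t[
    (fun s => (Gamma_fun a)%:E * (gker a (t - s) * f s)%:E)%E.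
  apply: integrableZl => //; apply: integrableS (cconv_integrable t ga fa) => //.
apply: eq_integrable => // s; rewrite inE/= in_itv/= => /andP[s0 st].
by rewrite powR_gker// wf// inE/= in_itv/= s0 (le_trans (ltW st)).
Qed.

Lemma RL_integral_adm a f w t T : 0 <= a -> admissible f -> 0 < t <= T ->
  {in `]0, T]%classic, w =1 f} -> RL_integral a w t = frac_int a f t.
Proof.
rewrite le_eqVlt /RL_integral /frac_int => /predU1P[<-|a0] fa tT wf.
  by rewrite eqxx wf// inE/= in_itv.
have ga := adm_gker a0; have /andP[t0 tT'] := tT.
have /gt_eqF/negbT G0 := Gamma_fun_gt0 a0.
rewrite gt_eqF//.
have -> : \int[mu]_(s in `]0, t[) ((t - s) `^ (a - 1) * w s) =
          \int[mu]_(s in `]0, t[) (Gamma_fun a * (gker a (t - s) * w s)).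
  apply: eq_Rintegral => s; rewrite inE/= in_itv/= => /andP[_ st].
  exact: powR_gker.
rewrite RintegralZl//.
  rewrite mulrA mulVf// mul1r cconv.unlock [LHS]Rintegral_mkcond; apply: eq_Rintegral => s _.
  exact: (cconv_patch s ga fa tT' wf).
apply/(integrable_mkcond _ _).2 => //.
have := cconv_integrable t ga fa; apply: eq_integrable => // s _ /=.
by rewrite -(cconv_patch s ga fa tT' wf) !patchE; case: ifP.
Qed.

Lemma g_convol_adm a f w t T : 0 <= a -> admissible f -> 0 < t <= T ->
  {in `]0, T]%classic, w =1 f} -> g_convol a w t = frac_int a f t.
Proof.
rewrite le_eqVlt /g_convol /frac_int => /predU1P[<-|a0] fa tT wf.
  by rewrite eqxx wf// inE/= in_itv.
have ga := adm_gker a0; have /andP[t0 tT'] := tT.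
rewrite gt_eqF// /convol.
have -> : \int[mu]_(s in `]0, t[) (g_kernel a (t - s) * w s) =
          \int[mu]_(s in `]0, t[) (gker a (t - s) * w s).
  apply: eq_Rintegral => s; rewrite inE/= in_itv/= => /andP[_ st].
  by rewrite gkerE// subr_gt0.
rewrite cconv.unlock [LHS]Rintegral_mkcond; apply: eq_Rintegral => s _.
exact: (cconv_patch s ga fa tT' wf).
Qed.

Lemma derive_on_cconv1 f g T t (k : R) : admissible g -> 0 < t <= T ->
  {in `]0, T]%classic, f =1 (fun t => k + cconv (gker 1) g t)} ->
  cvg (diff_quot f t s @[s --> within `]0, T] t^']) /\ derive_on `]0, T] f t = g t.
Proof.
move=> ga tT fg; apply: (derive_on_eq tT fg).
have /andP[t0 _] := tT.
have := @is_deriveD _ _ _ (fun=> k) (cconv (gker 1) g) t 1 0 (g t) (is_derive_cst _ _ _)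
  (is_derive_cconv1 ga t0).
by rewrite add0r.
Qed.

Lemma cvg_add_cconv1 f g T (k : R) : 0 < T -> admissible g ->
  {in `]0, T]%classic, f =1 (fun t => k + cconv (gker 1) g t)} ->
  f t @[t --> 0^'+] --> k.
Proof.
move=> T0 ga fg.
have H : k + cconv (gker 1) g t @[t --> 0^'+] --> k + 0.
  exact: (cvgD (cvg_cst k) (cconv1_cvg0 ga)).
rewrite addr0 in H; apply: cvg_trans H; apply: near_eq_cvg; near=> t.
rewrite fg// inE/= in_itv/=; apply/andP; split.
  by near: t; exact: nbhs_right_gt.
by near: t; exact: nbhs_right_le.
Unshelve. all: by end_near. Qed.

End fractional_integral.

(** * The candidate, its second derivative and their fractional integrals *)

Section solution_formula.
Context {R : realType}.
Variables (gamma b c x y e : R) (h : R -> R).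
Hypotheses (gamma_gt1 : 1 < gamma) (b_ge0 : 0 <= b) (b_lt1 : b < 1).
Hypothesis ha : admissible h.
Local Notation E := (mlker gamma c).
Local Notation H := (e \*o gker 1 \+ cconv (gker 1) h).

Let gamma_gt0 : 0 < gamma. Proof. exact: lt_trans ltr01 gamma_gt1. Qed.
Let index0 : 0 < gamma + b - 1.
Proof. by rewrite addrAC ltr_wpDr// subr_gt0. Qed.
Let index1 : 0 < gamma + b. Proof. by rewrite ltr_wpDr. Qed.
Let index2 : 0 < gamma - 1. Proof. by rewrite subr_gt0. Qed.
Let index3 : 0 < 1 - b. Proof. by rewrite subr_gt0. Qed.
Let kA : admissible (gker 1 : R -> R). Proof. exact: adm_gker ltr01. Qed.
Let EA s : 0 < s -> admissible (E s). Proof. exact: adm_mlker. Qed.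

(** Here [e] and [h] stand for eta(0) and the extended derivative of eta, so that [H] represents
    eta. *)
Definition sol_fun := x \*o E (gamma + b - 1) \+ (y \*o E (gamma + b) \+ cconv (E gamma) H).

(** In g_a * w the terms in [x] and [y] have indices 1 and 2, too small to be lowered by 2. The
    recurrence first splits off g_1 and g_2, which carry the initial values; the remainders, c times
    the kernels of indices 1 + gamma and 2 + gamma, come down to gamma - 1 and gamma. *)
Definition sol_der2 := (c * x) \*o E (gamma - 1) \+ ((c * y) \*o E gamma
  \+ (e \*o E (1 - b) \+ cconv (E (1 - b)) h)).

Lemma adm_primitive : admissible H.
Proof. exact: (admD (admZ e kA) (adm_cconv kA ha)). Qed.

Lemma adm_sol_fun : admissible sol_fun.
Proof.
exact: (admD (admZ x (EA index0)) (admD (admZ y (EA index1))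
  (adm_cconv (EA gamma_gt0) adm_primitive))).
Qed.

Let adm_tail : admissible (e \*o E (1 - b) \+ cconv (E (1 - b)) h).
Proof. exact: (admD (admZ e (EA index3)) (adm_cconv (EA index3) ha)). Qed.

Lemma adm_sol_der2 : admissible sol_der2.
Proof.
exact: (admD (admZ (c * x) (EA index2)) (admD (admZ (c * y) (EA gamma_gt0)) adm_tail)).
Qed.

(** Integration by parts in algebraic form: associativity moves the integration from [h] to the
    kernel, raising its index by 1, and the term in [e] is the boundary term. *)
Lemma cconv_mlker_primitive s : 0 < s ->
  cconv (E s) H = e \*o E (1 + s) \+ cconv (E (1 + s)) h.
Proof.
move=> s0; have sA := EA s0.
rewrite (cconvDr sA (admZ e kA) (adm_cconv kA ha)) (cconvZr e sA kA) (cconvA sA kA ha).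
by rewrite (cconvC sA kA) (cconv_gker_mlker c gamma_gt0 ltr01 s0).
Qed.

(** The order is left free for two uses: [d = 1 + 1] integrates back to the candidate, [d = b]
    evaluates the Hilfer derivative. *)
Lemma frac_int_sol_der2 d : 0 <= d ->
  frac_int d sol_der2 = (c * x) \*o E (d + (gamma - 1))
    \+ ((c * y) \*o E (d + gamma) \+ (e \*o E (d + (1 - b)) \+ cconv (E (d + (1 - b))) h)).
Proof.
move=> d0; rewrite /sol_der2.
rewrite (frac_intD d0 (admZ _ (EA index2)) (admD (admZ _ (EA gamma_gt0)) adm_tail)).
rewrite (frac_intD d0 (admZ _ (EA gamma_gt0)) adm_tail).
rewrite (frac_intD d0 (admZ _ (EA index3)) (adm_cconv (EA index3) ha)).
rewrite (frac_intZ _ d0 (EA index2)) (frac_intZ _ d0 (EA gamma_gt0)) (frac_intZ _ d0 (EA index3)).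
rewrite (frac_int_cconv d0 (EA index3) ha).
rewrite (frac_int_mlker c gamma_gt0 d0 index2) (frac_int_mlker c gamma_gt0 d0 gamma_gt0).
by rewrite (frac_int_mlker c gamma_gt0 d0 index3).
Qed.

Lemma frac_int_sol_fun a : 0 <= a -> a + b = 2 - gamma ->
  frac_int a sol_fun = x \*o gker 1 \+ cconv (gker 1) (y \*o gker 1 \+ cconv (gker 1) sol_der2).
Proof.
move=> a0 abE; have aE : a = 2 - gamma - b by rewrite -abE addrK.
have ag0 : 0 < a + gamma by rewrite ltr_wpDl.
have g20 : 0 < 1 + 1 :> R by rewrite addr_gt0.
have gA := adm_primitive; have cA := adm_cconv (EA gamma_gt0) gA.
rewrite /sol_fun.
rewrite (frac_intD a0 (admZ _ (EA index0)) (admD (admZ _ (EA index1)) cA)).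
rewrite (frac_intD a0 (admZ _ (EA index1)) cA).
rewrite (frac_intZ _ a0 (EA index0)) (frac_intZ _ a0 (EA index1)).
rewrite (frac_int_cconv a0 (EA gamma_gt0) gA).
rewrite (frac_int_mlker c gamma_gt0 a0 index0) (frac_int_mlker c gamma_gt0 a0 index1).
rewrite (frac_int_mlker c gamma_gt0 a0 gamma_gt0) (cconv_mlker_primitive ag0).
have dA := adm_sol_der2.
rewrite (cconvDr kA (admZ y kA) (adm_cconv kA dA)) (cconvZr y kA kA) (cconvA kA kA dA).
rewrite (cconv_gker ltr01 ltr01).
have := frac_int_sol_der2 (ltW g20); rewrite {1}/frac_int (gt_eqF g20) => ->.
have -> : a + (gamma + b - 1) = 1 by rewrite aE; ring.
have -> : a + (gamma + b) = 1 + 1 by rewrite aE; ring.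
have -> : 1 + 1 + (gamma - 1) = 1 + gamma by ring.
have -> : 1 + 1 + (1 - b) = 1 + (a + gamma) by rewrite aE; ring.
rewrite (mlker_rec c gamma_gt0 ltr01) (mlker_rec c gamma_gt0 g20).
apply/funext => t /=.
move: (E (1 + gamma) t) (E (1 + 1 + gamma) t) (E (1 + (a + gamma)) t)
  (cconv (E (1 + (a + gamma))) h t) (gker 1 t) (gker (1 + 1) t) => A1 A2 A3 A4 A5 A6.
by ring.
Qed.

(** The terms in [x] and [y] already carry the factor [c]. The others reach the index b + (1 - b) =
    1, where the recurrence splits them into [H] and c times the convolution term of the
    candidate. *)
Lemma frac_int_sol_der2E : frac_int b sol_der2 = c \*o sol_fun \+ H.
Proof.
rewrite (frac_int_sol_der2 b_ge0) /sol_fun (cconv_mlker_primitive gamma_gt0).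
have -> : b + (gamma - 1) = gamma + b - 1 by ring.
have -> : b + gamma = gamma + b by ring.
have -> : b + (1 - b) = 1 by ring.
have g10 : 0 < 1 + gamma by rewrite addr_gt0.
rewrite (mlker_rec c gamma_gt0 ltr01) (cconvDl kA (admZ c (EA g10)) ha).
rewrite (cconvZl c (EA g10) ha).
apply/funext => t /=.
move: (E (gamma + b - 1) t) (E (gamma + b) t) (E (1 + gamma) t)
  (cconv (E (1 + gamma)) h t) (gker 1 t) (cconv (gker 1) h t) => A1 A2 A3 A4 A5 A6.
by ring.
Qed.

End solution_formula.

Theorem lemma1 (R : realType) (gamma delta T c x y : R) (eta : R -> R)
    (hgamma : 1 < gamma < 2) (hdelta : 0 <= delta <= 1) (hT : 0 < T)
    (heta : C1_on `[0, T] eta) :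
  is_solution T gamma delta c eta x y
    (fun t : R =>
       t `^ (gamma + delta * (2 - gamma) - 2)
         * mittag_leffler gamma (gamma + delta * (2 - gamma) - 1)
             (c * t `^ gamma) * x
       + t `^ (gamma + delta * (2 - gamma) - 1)
         * mittag_leffler gamma (gamma + delta * (2 - gamma))
             (c * t `^ gamma) * y
       + \int[@lebesgue_measure R]_(s in `]0, t[)
           ((t - s) `^ (gamma - 1)
            * mittag_leffler gamma gamma (c * (t - s) `^ gamma) * eta s)).
Proof.
set w := (X in is_solution _ _ _ _ _ _ _ X).
have /andP[g1 g2] := hgamma; have /andP[d0 d1] := hdelta.
rewrite /is_solution /hilfer_exists /hilfer.
set a := (1 - delta) * (2 - gamma); set b := delta * (2 - gamma).
have a0 : 0 <= a by rewrite mulr_ge0// subr_ge0// ltW.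
have b0 : 0 <= b by rewrite mulr_ge0// subr_ge0// ltW.
have abE : a + b = 2 - gamma by rewrite /a /b; ring.
(* Since [a] is nonnegative, b <= 2 - gamma < 1. *)
have b1 : b < 1 by lra.
have [h ha etaE] := C1_on_primitive hT heta.
pose H := eta 0 \*o gker 1 \+ cconv (gker 1) h.
have HA : admissible H := adm_primitive (eta 0) ha.
have HE : {in `]0, T]%classic, eta =1 H}.
  move=> s; rewrite inE/= in_itv/= => sT; have /andP[s0 _] := sT.
  by rewrite /H /= (gker1 s0) mulr1; exact: etaE.
pose W := sol_fun gamma b c x y (eta 0) h.
have WA : admissible W := adm_sol_fun c x y (eta 0) g1 b0 ha.
have wW : {in `]0, T]%classic, w =1 W}.
  move=> t; rewrite inE/= in_itv/= => /andP[t0 tT].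
  rewrite /w /W /sol_fun /= -/b addrA; congr (_ + _ + _).
  - rewrite mulrC mlker.unlock (pospowE _ t0); congr (_ * (_ `^ _ * _)); ring.
  - by rewrite mulrC mlker.unlock (pospowE _ t0).
  - have E3 := adm_mlker c (lt_trans ltr01 g1) (lt_trans ltr01 g1).
    rewrite -/H cconv.unlock [LHS]Rintegral_mkcond; apply: eq_Rintegral => s _.
    rewrite -(cconv_patch s E3 HA tT HE) !patchE; case: ifPn => [|_]; last by [].
    rewrite inE/= in_itv/= => /andP[_ st]; have st0 : 0 < t - s by rewrite subr_gt0.
    by rewrite mlker.unlock (pospowE _ st0).
pose F := sol_der2 gamma b c x y (eta 0) h.
have FA : admissible F := adm_sol_der2 c x y (eta 0) g1 b1 ha.
pose P := y \*o gker 1 \+ cconv (gker 1) F.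
have kA := adm_gker (@ltr01 R).
have PA : admissible P := admD (admZ y kA) (adm_cconv kA FA).
have WE : frac_int a W = x \*o gker 1 \+ cconv (gker 1) P.
  exact: frac_int_sol_fun.
have FE : frac_int b F = c \*o W \+ H by exact: frac_int_sol_der2E.
have VE t : 0 < t <= T -> RL_integral a w t = x + cconv (gker 1) P t.
  move=> tT; rewrite (RL_integral_adm a0 WA tT wW) WE /= gker1 ?mulr1//.
  by case/andP: tT.
(* The equation is stated through [RL_integral] and the initial conditions through [g_convol]; both
   have the same representation on ]0, T]. *)
have GE t : 0 < t <= T -> g_convol a w t = x + cconv (gker 1) P t.
  move=> tT; rewrite (g_convol_adm a0 WA tT wW) WE /= gker1 ?mulr1//.
  by case/andP: tT.
have VE' : {in `]0, T]%classic, RL_integral a w =1 (fun t => x + cconv (gker 1) P t)}.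
  by move=> t; rewrite inE/= in_itv/=; exact: VE.
have GE' : {in `]0, T]%classic, g_convol a w =1 (fun t => x + cconv (gker 1) P t)}.
  by move=> t; rewrite inE/= in_itv/=; exact: GE.
have PE t : 0 < t <= T -> P t = y + cconv (gker 1) F t.
  by move=> /andP[t0 _]; rewrite /P/= gker1// mulr1.
have dVE : {in `]0, T]%classic,
    derive_on `]0, T] (RL_integral a w) =1 (fun t => y + cconv (gker 1) F t)}.
  move=> t; rewrite inE/= in_itv/= => tT.
  by rewrite (derive_on_cconv1 PA tT VE').2 PE.
have dGE : {in `]0, T]%classic,
    derive_on `]0, T] (g_convol a w) =1 (fun t => y + cconv (gker 1) F t)}.
  move=> t; rewrite inE/= in_itv/= => tT.
  by rewrite (derive_on_cconv1 PA tT GE').2 PE.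
have ddVE : {in `]0, T]%classic,
    derive_on `]0, T] (derive_on `]0, T] (RL_integral a w)) =1 F}.
  move=> t; rewrite inE/= in_itv/= => tT.
  by rewrite (derive_on_cconv1 FA tT dVE).2.
split.
- split.
  + by move=> t tT; exact: RL_integrable_adm wW.
  + move=> t; rewrite /= in_itv/= => tT; exact: (derive_on_cconv1 PA tT VE').1.
  + move=> t; rewrite /= in_itv/= => tT; exact: (derive_on_cconv1 FA tT dVE).1.
  + by move=> t tT; exact: RL_integrable_adm ddVE.
- move=> t tT; rewrite (RL_integral_adm b0 FA tT ddVE) FE /=.
  by rewrite -wW ?inE/= ?in_itv// -HE ?inE/= ?in_itv.
- exact: cvg_add_cconv1 GE'.
- exact: cvg_add_cconv1 dGE.
Qed.
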